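(* For $n\ge1$, the even part of the supercenter of $ONH_n$ (i.e. the set of even elements $z\in ONH_n$ with $za=az$ for all $a\in ONH_n$) equals the subalgebra of $OPol_n\subseteq ONH_n$ consisting of symmetric polynomials in $x_1^2,\dots,x_n^2$. This also coincides with the even part of the supercenter of $OSym_n$, under the natural embedding $OSym_n\subseteq OPol_n\subseteq ONH_n$.
   Context: $\Bbbk$ is a field of characteristic $\neq2$. $OPol_n$: graded superalgebra generated by odd degree-2 $x_1,\dots,x_n$ with $x_jx_i=-x_ix_j$ ($i\ne j$); note $x_1^2,\dots,x_n^2$ are even and mutually commute. $OSym_n\subseteq OPol_n$ is the subalgebra generated by $e^{(n)}_r:=\sum_{1\le i_1<\cdots<i_r\le n}x_{i_1}\cdots x_{i_r}$. The supercenter of a superalgebra $B$ is $\{c: bc=(-1)^{\mathrm{par}(b)\mathrm{par}(c)}cb\ \forall b\}$. $ONH_n$ is the graded superalgebra generated by odd $x_1,\dots,x_n$ (degree 2) and $\tau_1,\dots,\tau_{n-1}$ (degree $-2$) with relations $x_ix_j=-x_jx_i$ ($i\ne j$), $\tau_i\tau_j=-\tau_j\tau_i$ ($|i-j|>1$), $x_i\tau_j=-\tau_jx_i$ ($i\ne j,j+1$), $\tau_j^2=0$, $\tau_j\tau_{j+1}\tau_j=-\tau_{j+1}\tau_j\tau_{j+1}$, $x_i\tau_i-\tau_ix_{i+1}=1=\tau_ix_i-x_{i+1}\tau_i$; the subalgebra generated by $x_1,\dots,x_n$ is identified with $OPol_n$ (the natural map is injective). *)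

(* Defs.v *)
From HB Require Import structures.
From mathcomp Require Import all_boot all_order all_algebra.
From mathcomp Require Import mpoly.
Set Implicit Arguments. Unset Strict Implicit. Unset Printing Implicit Defensive.
Import GRing.Theory.
Local Open Scope ring_scope.

Definition alg_hom (k : fieldType) (A B : algType k) (f : A -> B) : Prop :=
  [/\ forall (a : k) (u v : A), f (a *: u + v) = a *: f u + f v,
      forall u v : A, f (u * v) = f u * f v
    & f 1 = 1].

(* Defining relations of the odd nilHecke algebra ONH_n, 0-indexed:
   x i (i < n) and t j (j < n-1); t j sits between x j and x (j+1). *)
Definition ONH_rel (k : fieldType) (n : nat) (B : algType k)
    (x : 'I_n -> B) (t : 'I_n.-1 -> B) : Prop :=
  (forall i j : 'I_n, i != j -> x i * x j = - (x j * x i)) /\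
  (forall i j : 'I_n.-1, ((i.+1 < j)%N || (j.+1 < i)%N) ->
     t i * t j = - (t j * t i)) /\
  (forall (i : 'I_n) (j : 'I_n.-1), (i : nat) != j -> (i : nat) != j.+1 ->
     x i * t j = - (t j * x i)) /\
  (forall j : 'I_n.-1, t j * t j = 0) /\
  (forall j j' : 'I_n.-1, (j' : nat) = j.+1 ->
     t j * t j' * t j = - (t j' * t j * t j')) /\
  (forall (j : 'I_n.-1) (i i' : 'I_n), (i : nat) = j -> (i' : nat) = j.+1 ->
     x i * t j - t j * x i' = 1 /\ t j * x i - x i' * t j = 1).

Definition is_ONH (k : fieldType) (n : nat) (A : algType k)
    (x : 'I_n -> A) (t : 'I_n.-1 -> A) : Prop :=
  ONH_rel x t /\
  forall (B : algType k) (y : 'I_n -> B) (s : 'I_n.-1 -> B), ONH_rel y s ->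
    exists f : A -> B,
      [/\ alg_hom f, (forall i, f (x i) = y i), (forall j, f (t j) = s j)
        & forall g : A -> B, alg_hom g -> (forall i, g (x i) = y i) ->
            (forall j, g (t j) = s j) -> g =1 f].

Definition in_word_span (k : fieldType) (A : algType k) (I : Type)
    (g : I -> A) (P : seq I -> bool) (z : A) : Prop :=
  exists s : seq (k * seq I),
    z = \sum_(p <- s) p.1 *: \prod_(i <- p.2) g i /\ all (fun p => P p.2) s.

Definition ONH_gen (k : fieldType) (n : nat) (A : algType k)
    (x : 'I_n -> A) (t : 'I_n.-1 -> A) (g : 'I_n + 'I_n.-1) : A :=
  match g with inl i => x i | inr j => t j end.

(* even part of the superalgebra: span of even-length words in the
   (odd) generators *)
Definition ONH_even (k : fieldType) (n : nat) (A : algType k)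
    (x : 'I_n -> A) (t : 'I_n.-1 -> A) (z : A) : Prop :=
  in_word_span (ONH_gen x t) (fun w => ~~ odd (size w)) z.

Definition oelem (k : fieldType) (n : nat) (A : algType k)
    (x : 'I_n -> A) (r : 'I_n.+1) : A :=
  \sum_(S : {set 'I_n} | #|S| == (r : nat)) \prod_(i <- enum S) x i.

Definition in_OSym (k : fieldType) (n : nat) (A : algType k)
    (x : 'I_n -> A) (z : A) : Prop :=
  in_word_span (oelem x) predT z.

Definition eval_sq (k : fieldType) (n : nat) (A : algType k)
    (x : 'I_n -> A) (p : {mpoly k[n]}) : A :=
  \sum_(m <- msupp p) p@_m *: \prod_(i < n) (x i ^+ 2) ^+ m i.

Definition sym_in_squares (k : fieldType) (n : nat) (A : algType k)
    (x : 'I_n -> A) (z : A) : Prop :=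
  exists p : {mpoly k[n]}, p \is symmetric /\ z = eval_sq x p.

(* Main.v *)
(* Let ONH_n act on OPol_n through odd divided differences.  Modulo the left
   ideal generated by the tau_j, which kills the vector 1 of this module, an
   even z in ONH_n equals an even skew polynomial f.  If z is central, then f
   is annihilated by the divided differences and commutes with every e_r,
   because tau_j e_r lies in ONH_n tau_j.

   An even f that commutes with the e_r commutes with each x_i: in the product
   prod_l (W + x_l), where W is a central square root of x_i^2, the factor
   W + x_i is a multiple of an idempotent and the others are invertible up to
   torsion.  Evenness then makes f a polynomial p in the x_i^2, and the
   vanishing of the divided differences of f makes p symmetric.

   Finally z = f: the difference z - f commutes with the x_i and kills the
   element theta attached to the longest permutation, and the two-sided ideal
   of theta contains 1.  Conversely, the elementary symmetric polynomials of the
   x_i^2 are the coefficients of prod_i (T + x_i) * prod_i^rev (T - x_i), and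
   symmetric polynomials in the x_i^2 commute with all the generators. *)

Require Import Defs.
From HB Require Import structures.
From mathcomp Require Import all_boot all_order all_fingroup all_algebra.
From mathcomp Require Import mpoly ring zify.
From mathcomp Require boolp.
Set Implicit Arguments. Unset Strict Implicit. Unset Printing Implicit Defensive.
Import GRing.Theory.
Local Open Scope ring_scope.

(** * Endomorphism algebras *)

Section Endomorphisms.
Variables (k : fieldType) (V : lalgType k).

(** The universal property in [is_ONH] ranges over [algType k], so the operators of the polynomial
    representation have to form an algebra. *)
Record endo : Type := Endo { endo_fun :> V -> V; endo_linear : linear endo_fun }.

Lemma endoP (f g : endo) : f =1 g -> f = g.
Proof.
case: f g => [f fL] [g gL] /= /boolp.funext fg; case: _ / fg in gL *.
by rewrite (boolp.Prop_irrelevance fL gL).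
Qed.

HB.instance Definition _ := boolp.gen_eqMixin endo.
HB.instance Definition _ := boolp.gen_choiceMixin endo.

Fact endo_zero_linear : linear (fun _ : V => 0 : V).
Proof. by move=> a u v; rewrite scaler0 addr0. Qed.
Fact endo_opp_linear (f : endo) : linear (fun v => - f v).
Proof. by move=> a u v; rewrite (endo_linear f) opprD scalerN. Qed.
Fact endo_add_linear (f g : endo) : linear (fun v => f v + g v).
Proof. by move=> a u v; rewrite !endo_linear scalerDr addrACA. Qed.
Fact endo_one_linear : linear (fun v : V => v).
Proof. by []. Qed.
Fact endo_mul_linear (f g : endo) : linear (fun v => f (g v)).
Proof. by move=> a u v; rewrite !endo_linear. Qed.
Fact endo_scale_linear (c : k) (f : endo) : linear (fun v => c *: f v).
Proof. by move=> a u v; rewrite endo_linear scalerDr !scalerA mulrC. Qed.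

Definition endo_zero := Endo endo_zero_linear.
Definition endo_opp f := Endo (endo_opp_linear f).
Definition endo_add f g := Endo (endo_add_linear f g).
Definition endo_one := Endo endo_one_linear.
Definition endo_mul f g := Endo (endo_mul_linear f g).
Definition endo_scale c f := Endo (endo_scale_linear c f).

Fact endo_addA : associative endo_add.
Proof. by move=> f g h; apply: endoP => v /=; rewrite addrA. Qed.
Fact endo_addC : commutative endo_add.
Proof. by move=> f g; apply: endoP => v /=; rewrite addrC. Qed.
Fact endo_add0 : left_id endo_zero endo_add.
Proof. by move=> f; apply: endoP => v /=; rewrite add0r. Qed.
Fact endo_addN : left_inverse endo_zero endo_opp endo_add.
Proof. by move=> f; apply: endoP => v /=; rewrite addNr. Qed.
HB.instance Definition _ :=
  GRing.isZmodule.Build endo endo_addA endo_addC endo_add0 endo_addN.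

Lemma endoB (f : endo) u v : f (u - v) = f u - f v.
Proof. by have := endo_linear f (-1) v u; rewrite !scaleN1r ![- _ + _]addrC. Qed.
Lemma endo0 (f : endo) : f 0 = 0.
Proof. by have := endoB f 0 0; rewrite !subrr. Qed.
Lemma endoN (f : endo) v : f (- v) = - f v.
Proof. by rewrite -sub0r endoB endo0 sub0r. Qed.
Lemma endoD (f : endo) u v : f (u + v) = f u + f v.
Proof. by rewrite -[u in LHS]scale1r endo_linear scale1r. Qed.
Lemma endoZ (f : endo) a v : f (a *: v) = a *: f v.
Proof. by rewrite -[_ *: v]addr0 endo_linear endo0 addr0. Qed.

Fact endo_mulA : associative endo_mul.
Proof. by move=> f g h; apply: endoP. Qed.
Fact endo_mul1l : left_id endo_one endo_mul.
Proof. by move=> f; apply: endoP. Qed.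
Fact endo_mul1r : right_id endo_one endo_mul.
Proof. by move=> f; apply: endoP. Qed.
Fact endo_mulDl : left_distributive endo_mul endo_add.
Proof. by move=> f g h; apply: endoP. Qed.
Fact endo_mulDr : right_distributive endo_mul endo_add.
Proof. by move=> f g h; apply: endoP => v /=; rewrite endoD. Qed.
Fact endo_one_neq0 : endo_one != 0.
Proof. by apply/eqP => /(congr1 (fun f : endo => f 1)) /eqP; rewrite oner_eq0. Qed.
HB.instance Definition _ := GRing.Zmodule_isNzRing.Build endo
  endo_mulA endo_mul1l endo_mul1r endo_mulDl endo_mulDr endo_one_neq0.

Fact endo_scaleA a b f : endo_scale a (endo_scale b f) = endo_scale (a * b) f.
Proof. by apply: endoP => v /=; rewrite scalerA. Qed.
Fact endo_scale1 : left_id 1 endo_scale.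
Proof. by move=> f; apply: endoP => v /=; rewrite scale1r. Qed.
Fact endo_scaleDr : right_distributive endo_scale +%R.
Proof. by move=> a f g; apply: endoP => v /=; rewrite scalerDr. Qed.
Fact endo_scaleDl f : {morph endo_scale^~ f : a b / a + b}.
Proof. by move=> a b; apply: endoP => v /=; rewrite scalerDl. Qed.
HB.instance Definition _ := GRing.Zmodule_isLmodule.Build k endo
  endo_scaleA endo_scale1 endo_scaleDr endo_scaleDl.

Fact endo_scaleAl (a : k) (f g : endo) : a *: (f * g) = (a *: f) * g.
Proof. by apply: endoP. Qed.
HB.instance Definition _ := GRing.Lmodule_isLalgebra.Build k endo endo_scaleAl.
Fact endo_scaleAr (a : k) (f g : endo) : a *: (f * g) = f * (a *: g).
Proof. by apply: endoP => v; rewrite [RHS]endoZ. Qed.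
HB.instance Definition _ := GRing.Lalgebra_isAlgebra.Build k endo endo_scaleAr.

Lemma endoNE (f : endo) v : (- f) v = - f v. Proof. by []. Qed.
Lemma endoDE (f g : endo) v : (f + g) v = f v + g v. Proof. by []. Qed.
Lemma endoME (f g : endo) v : (f * g) v = f (g v). Proof. by []. Qed.

End Endomorphisms.

(** * Dual numbers *)

Section DualNumbers.
Variables (k : fieldType) (A : algType k).

(** [(a, b)] stands for [a + e b] with [e] central of square zero; an algebra map whose first
    component is the identity encodes a derivation in its second. *)
Definition dual : Type := (A * A)%type.
HB.instance Definition _ := GRing.Lmodule.on dual.

Definition dual_one : dual := (1, 0).
Definition dual_mul (u v : dual) : dual := (u.1 * v.1, u.1 * v.2 + u.2 * v.1).

Fact dual_mulA : associative dual_mul.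
Proof.
by move=> u v w; congr pair; rewrite /= ?mulrA // mulrDr mulrDl !mulrA addrA.
Qed.
Fact dual_mul1l : left_id dual_one dual_mul.
Proof. by case=> a b; rewrite /dual_mul /= !mul1r mul0r addr0. Qed.
Fact dual_mul1r : right_id dual_one dual_mul.
Proof. by case=> a b; rewrite /dual_mul /= !mulr1 mulr0 add0r. Qed.
Fact dual_mulDl : left_distributive dual_mul +%R.
Proof. by move=> u v w; congr pair; rewrite /= !mulrDl // addrACA. Qed.
Fact dual_mulDr : right_distributive dual_mul +%R.
Proof. by move=> u v w; congr pair; rewrite /= !mulrDr // addrACA. Qed.
Fact dual_one_neq0 : dual_one != 0.
Proof. by apply/eqP => /(congr1 fst) /eqP; rewrite oner_eq0. Qed.
HB.instance Definition _ := GRing.Zmodule_isNzRing.Build dual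
  dual_mulA dual_mul1l dual_mul1r dual_mulDl dual_mulDr dual_one_neq0.
Lemma dualM (u v : dual) : u * v = (u.1 * v.1, u.1 * v.2 + u.2 * v.1) :> dual.
Proof. by []. Qed.
Lemma dualZ (a : k) (u : dual) : a *: u = (a *: u.1, a *: u.2) :> dual.
Proof. by []. Qed.
Fact dual_scaleAl (a : k) (u v : dual) : a *: (u * v : dual) = (a *: u : dual) * v.
Proof. by rewrite !dualM !dualZ /= scalerDr !scalerAl. Qed.
HB.instance Definition _ := GRing.Lmodule_isLalgebra.Build k dual dual_scaleAl.
Fact dual_scaleAr (a : k) (u v : dual) : a *: (u * v : dual) = u * (a *: v : dual).
Proof. by rewrite !dualM !dualZ /= scalerDr !scalerAr. Qed.
HB.instance Definition _ := GRing.Lalgebra_isAlgebra.Build k dual dual_scaleAr.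

End DualNumbers.

(** * Normally ordered skew polynomials *)

Definition anticommuting (R : pzRingType) (n : nat) (c : 'I_n -> R) :=
  forall i j : 'I_n, i != j -> c i * c j = - (c j * c i).

Lemma mpoly_linear_ext (k : fieldType) (n : nat) (U : lmodType k)
    (f g : {mpoly k[n]} -> U) : linear f -> linear g ->
  (forall m, f 'X_[m] = g 'X_[m]) -> f =1 g.
Proof.
move=> fL gL fg P.
have h0 (h : {mpoly k[n]} -> U) : linear h -> h 0 = 0.
  by move=> hL; have := hL (-1) 0 0; rewrite scaler0 addr0 scaleN1r addNr.
rewrite [P]mpolyE; elim: (msupp P) => [|m s IHs]; first by rewrite big_nil !h0.
by rewrite big_cons fL gL fg IHs.
Qed.

Lemma mpoly_mulX_ind (k : fieldType) (n : nat) (Q : {mpoly k[n]} -> Prop) :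
    (forall a P P', Q P -> Q P' -> Q (a *: P + P')) -> Q 1 ->
    (forall i m, Q 'X_[m] -> Q 'X_[m + U_(i)]) ->
  forall P, Q P.
Proof.
move=> QD Q1 QX.
have QXm d m : mdeg m = d -> Q 'X_[m].
  elim: d m => [|d IHd] m md.
    by have /eqP := md; rewrite mdeg_eq0 => /eqP ->; rewrite mpolyX0.
  have [i mi] : exists i, m i != 0%N.
    apply/existsP; apply: contraPT md => /existsPn m0.
    by rewrite mdegE big1 // => i _; apply/eqP; rewrite -[_ == _]negbK.
  have Em : m = (m - U_(i) + U_(i))%MM by rewrite submK // lep1mP.
  rewrite Em; apply/QX/IHd.
  by move: md; rewrite {1}Em mdegD mdeg1 addn1 => -[].
move=> P; rewrite [P]mpolyE; elim: (msupp P) => [|m s IHs].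
  by rewrite big_nil -(addNr 1) -scaleN1r; apply: QD.
by rewrite big_cons; apply: QD => //; apply: QXm erefl.
Qed.

Lemma mpolyXm_neq0 (R : nzRingType) (n : nat) (m : 'X_{1..n}) : 'X_[R, m] != 0.
Proof.
by apply/eqP => /(congr1 (mcoeff m)) /eqP; rewrite mcoeffX eqxx mcoeff0 oner_eq0.
Qed.

(* The span of the monomials X^m stands for the skew polynomial algebra
   through the normal ordering x_0^m_0 x_1^m_1 ...; [skewX i] is then left
   multiplication by x_i, which changes sign when passing x_l for l < i. *)
Definition skew_sign (k : fieldType) (n : nat) (i : 'I_n) (P : {mpoly k[n]}) :=
  P \mPo [tuple (if (l < i)%N then - 'X_l else 'X_l) | l < n].
HB.lock Definition skewX (k : fieldType) (n : nat) (i : 'I_n) (P : {mpoly k[n]}) :=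
  'X_i * skew_sign i P.

Section SkewPolynomials.
Variables (k : fieldType) (n : nat).
Local Notation V := {mpoly k[n]}.
Implicit Types P Q : V.

HB.instance Definition _ i := GRing.RMorphism.copy (@skew_sign k n i)
  (comp_mpoly [tuple (if (l < i)%N then - 'X_l else 'X_l) | l < n]).
HB.instance Definition _ i := GRing.Linear.copy (@skew_sign k n i)
  (comp_mpoly [tuple (if (l < i)%N then - 'X_l else 'X_l) | l < n]).

Lemma skewXE i P : skewX i P = 'X_i * skew_sign i P.
Proof. by rewrite unlock. Qed.

Lemma skew_signX i l :
  skew_sign i 'X_l = (if (l < i)%N then - 'X_l else 'X_l) :> V.
Proof. by rewrite /skew_sign comp_mpolyXU -tnth_nth tnth_mktuple. Qed.

Lemma skew_signXm i m :
  skew_sign i 'X_[m] = (-1) ^+ (\sum_(l < n | (l < i)%N) m l) *: 'X_[m] :> V.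
Proof.
rewrite /skew_sign comp_mpolyX.
under eq_bigr => l _ do rewrite tnth_mktuple.
rewrite [X in _ *: X]mpolyXE_id -mul_mpolyC rmorphXn rmorphN rmorph1 /= -prodrXr.
rewrite [X in X * _]big_mkcond -big_split /=; apply: eq_bigr => l _.
by case: ifP; rewrite ?mul1r // -exprMn mulN1r.
Qed.

Lemma skewX_linear i : linear (@skewX k n i).
Proof.
by move=> a P Q; rewrite !skewXE linearP /= mulrDr scalerAr.
Qed.

HB.instance Definition _ i :=
  GRing.isLinear.Build k V V *:%R (@skewX k n i) (skewX_linear i).
Lemma skewXD i P Q : skewX i (P + Q) = skewX i P + skewX i Q.
Proof. exact: linearD. Qed.
Lemma skewXN i P : skewX i (- P) = - skewX i P. Proof. exact: linearN. Qed.
Lemma skewXB i P Q : skewX i (P - Q) = skewX i P - skewX i Q.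
Proof. exact: linearB. Qed.
Lemma skewXZ i a P : skewX i (a *: P) = a *: skewX i P. Proof. exact: linearZ. Qed.
Lemma skewX0 i : skewX i 0 = 0 :> V. Proof. exact: linear0. Qed.
Definition skewX_endo i : endo {mpoly k[n]} := Endo (skewX_linear i).

Lemma skew_signM i P Q : skew_sign i (P * Q) = skew_sign i P * skew_sign i Q.
Proof. exact: rmorphM. Qed.

Lemma skew_sign_comm i j P :
  skew_sign i (skew_sign j P) = skew_sign j (skew_sign i P).
Proof.
apply: (mpoly_linear_ext (f := skew_sign i \o skew_sign j)
  (g := skew_sign j \o skew_sign i)); [exact: linearP | exact: linearP |] => m /=.
by rewrite !skew_signXm !linearZ /= !skew_signXm !scalerA mulrC.
Qed.

Lemma skew_sign_inv i P : skew_sign i (skew_sign i P) = P.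
Proof.
apply: (mpoly_linear_ext (f := skew_sign i \o skew_sign i) (g := idfun));
  [exact: linearP | exact: linearP |] => m /=.
rewrite skew_signXm !linearZ /= skew_signXm !scalerA.
by rewrite -expr2 sqrr_sign scale1r.
Qed.

Lemma skewX_anti i j P : i != j -> skewX i (skewX j P) = - skewX j (skewX i P).
Proof.
wlog ij : i j / (i < j)%N => [hw|_].
  move=> nij; have := nij; rewrite neq_ltn => /orP[ij|ji]; first exact: hw.
  by rewrite (hw j i) ?opprK // eq_sym.
rewrite !skewXE !skew_signM !skew_signX ij ltnNge ltnW //=.
by rewrite skew_sign_comm mulNr mulrN opprK !mulrA ['X_j * _]mulrC.
Qed.

Lemma skewX_anticommuting : anticommuting skewX_endo.
Proof. by move=> i j ij; apply: endoP => P; apply: skewX_anti. Qed.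

Lemma skewX_sqr i P : skewX i (skewX i P) = 'X_i ^+ 2 * P.
Proof. by rewrite !skewXE skew_signM skew_signX ltnn skew_sign_inv mulrA. Qed.

Lemma skewX_inj i P : skewX i P = 0 -> P = 0.
Proof.
move=> /(congr1 (skewX i)); rewrite skewX_sqr linear0.
by move/eqP; rewrite mulf_eq0 expf_eq0 /= (negPf (mpolyXm_neq0 _ _)) => /eqP.
Qed.

Lemma skewX_Xm i m : skewX i 'X_[m] =
  (-1) ^+ (\sum_(l < n | (l < i)%N) m l) *: 'X_[m + U_(i)] :> V.
Proof. by rewrite skewXE skew_signXm -scalerAr mpolyXD mulrC. Qed.

(** Up to a sign, absorbed by closure under linear combinations, [skewX i] carries monomials to
    monomials; so the vector 1 generates the representation. *)
Lemma skewX_ind (Q : V -> Prop) :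
    (forall a P P', Q P -> Q P' -> Q (a *: P + P')) -> Q 1 ->
    (forall i P, Q P -> Q (skewX i P)) ->
  forall P, Q P.
Proof.
move=> QD Q1 QX; apply: mpoly_mulX_ind => // i m /(QX i).
rewrite skewX_Xm => /(QD ((-1) ^+ (\sum_(l < n | (l < i)%N) m l)) _ 0).
by rewrite scalerA -expr2 sqrr_sign scale1r addr0; apply; rewrite -(addNr 1) -scaleN1r; apply: QD.
Qed.

Section NormalForm.
Variables (C : algType k) (c : 'I_n -> C).

(** The polynomial is read as a normally ordered expression in the [c i]. For anticommuting [c] this
    is the algebra map out of the skew polynomials ([nf_skewX]); for commuting [c] it is ordinary
    evaluation ([nfM_comm]). *)
Definition nf (P : V) : C :=
  \sum_(m <- msupp P) P@_m *: \prod_(i < n) c i ^+ m i.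

Lemma nf_mmap P : nf P = mmap (in_alg C) c P.
Proof. by apply: eq_bigr => m _; rewrite /= mulr_algl. Qed.

Lemma nf_linear : linear nf.
Proof. by move=> a P Q; rewrite !nf_mmap mmapD mmapZ /= mulr_algl. Qed.
HB.instance Definition _ := GRing.isLinear.Build k V C _ nf nf_linear.

Lemma nfXm m : nf 'X_[m] = \prod_(i < n) c i ^+ m i.
Proof. by rewrite nf_mmap mmapX. Qed.

Lemma nf1 : nf 1 = 1.
Proof. by rewrite -mpolyX0 nfXm big1 // => i _; rewrite mnm0E. Qed.

Lemma nfM_comm : (forall i j, GRing.comm (c i) (c j)) -> {morph nf : P Q / P * Q}.
Proof.
move=> cc P Q; move: P; apply: mpoly_linear_ext => [a P P'|a P P'|m].
- by rewrite mulrDl -scalerAl linearP.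
- by rewrite linearP mulrDl -scalerAl.
move: Q; apply: mpoly_linear_ext => [a P P'|a P P'|m'].
- by rewrite mulrDr -scalerAr linearP.
- by rewrite linearP mulrDr -scalerAr.
rewrite -mpolyXD !nfXm -prodrM_comm => [|i j _ _]; last exact/commrX/commr_sym/commrX.
by apply: eq_bigr => i _; rewrite mnmDE exprD.
Qed.

Hypothesis anti_c : anticommuting c.

Lemma anticommuting_exp i j e :
  i != j -> c i * c j ^+ e = (-1) ^+ e *: (c j ^+ e * c i).
Proof.
move=> ij; elim: e => [|e IHe]; first by rewrite !expr0 mulr1 mul1r scale1r.
rewrite exprSr mulrA IHe -scalerAl -[_ * c i * c j]mulrA (anti_c ij).
by rewrite mulrN scalerN mulrA [in RHS]exprS mulN1r scaleNr.
Qed.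

Lemma mul_normal_monomial i (m : 'X_{1..n}) :
  c i * \prod_(l < n) c l ^+ m l =
  (-1) ^+ (\sum_(l < n | (l < i)%N) m l) *: \prod_(l < n) c l ^+ (m + U_(i))%MM l.
Proof.
(* The enumeration is increasing, so the powers that [c i] has to cross are exactly those listed
   before [i]. *)
have: pairwise (fun a b : 'I_n => (a < b)%N) (index_enum 'I_n).
  rewrite -(pairwise_map val ltn) -sorted_pairwise; last exact: ltn_trans.
  by rewrite /index_enum -enumT val_enum_ord iota_ltn_sorted.
have: i \in index_enum 'I_n by rewrite mem_index_enum.
elim: (index_enum _) => // a s IHs; rewrite inE pairwise_cons.
have [ia _|ia /= i_s] := eqVneq i a => /andP[/allP a_s s_s].
  rewrite -ia in a_s *; rewrite [\sum_(_ <- _ | _) _]big1_seq ?expr0 ?scale1r; last first.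
    move=> l /andP[li]; rewrite inE => /orP[/eqP El|/a_s il].
      by rewrite El ltnn in li.
    by rewrite ltnNge ltnW in li.
  rewrite !big_cons mulrA -exprS mnmDE mnm1E eqxx addn1; congr (_ * _).
  apply: eq_big_seq => l /a_s il; rewrite mnmDE mnm1E.
  by rewrite (_ : (i == l) = false) ?addn0 //; apply/eqP => E; rewrite E ltnn in il.
rewrite !big_cons (a_s _ i_s) mulrA anticommuting_exp // -scalerAl -mulrA IHs //.
by rewrite -scalerAr scalerA -exprD mnmDE mnm1E (negPf ia) addn0.
Qed.

Lemma nf_skewX i P : nf (skewX i P) = c i * nf P.
Proof.
apply: (mpoly_linear_ext (f := nf \o @skewX k n i) (g := fun P => c i * nf P)).
- by move=> a Q Q' /=; rewrite !linearP.
- by move=> a Q Q'; rewrite linearP mulrDr scalerAr.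
by move=> m /=; rewrite skewX_Xm linearZ /= !nfXm mul_normal_monomial.
Qed.

End NormalForm.

End SkewPolynomials.

(** * The polynomial representation *)

Section OddDividedDifference.
Variables (k : fieldType) (n : nat) (a b : 'I_n).
Hypothesis ab : a != b.
Local Notation V := {mpoly k[n]}.
Local Notation W := ({mpoly k[n]} * {mpoly k[n]})%type.
Local Notation X := (@skewX k n).

Definition dd_twist (i : 'I_n) (P : V) : V :=
  if i == a then X b P else if i == b then X a P else - X i P.
Definition dd_value (i : 'I_n) : k :=
  if i == a then 1 else if i == b then -1 else 0.

(* A skew derivation d with twist s and d(x_i) in k is the corner of an
   algebra map x_i |-> [[s(x_i), d(x_i)], [0, x_i]]; the anticommutation of
   these matrices makes the odd divided difference well defined. *)
Definition dd_matrix_fun (i : 'I_n) (u : W) : W :=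
  (dd_twist i u.1 + dd_value i *: u.2, X i u.2).

Lemma dd_twist_linear i : linear (dd_twist i).
Proof.
move=> c P Q; rewrite /dd_twist.
by do 2?[case: ifP => _]; rewrite linearP // opprD scalerN.
Qed.

Lemma dd_matrix_linear i : linear (dd_matrix_fun i).
Proof.
move=> c [u1 u2] [v1 v2]; rewrite /dd_matrix_fun; congr pair; last exact: linearP.
by rewrite /= dd_twist_linear !scalerDr !scalerA [c * _]mulrC addrACA.
Qed.
Definition dd_matrix i : endo W := Endo (dd_matrix_linear i).

(** Upper component of the anticommutation of two matrices. The twist swaps [x_a] with [x_b] and
    negates the other variables, so the terms in [u] anticommute and the terms in [v] agree on both
    sides. *)
Lemma dd_corner i j u v : i != j ->
  dd_twist i (dd_twist j u + dd_value j *: v) + dd_value i *: X j v =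
  - (dd_twist j (dd_twist i u + dd_value i *: v) + dd_value j *: X i v).
Proof.
have anti := @skewX_anti k n.
move=> ij; rewrite /dd_twist /dd_value.
have [ia|ia] := eqVneq i a; have [ja|ja] := eqVneq j a.
- by rewrite ia ja eqxx in ij.
- have [jb|jb] := eqVneq j b; rewrite !(skewXD, skewXN, skewXZ)
    ?(scale1r, scaleN1r, scale0r).
    by rewrite ia jb (anti a b) //; ring.
  by rewrite (anti b j) 1?eq_sym //; ring.
- have [ib|ib] := eqVneq i b; rewrite !(skewXD, skewXN, skewXZ)
    ?(scale1r, scaleN1r, scale0r).
    by rewrite ib ja (anti b a) 1?eq_sym //; ring.
  by rewrite (anti i b) //; ring.
have [ib|ib] := eqVneq i b; have [jb|jb] := eqVneq j b;
  rewrite !(skewXD, skewXN, skewXZ) ?(scale1r, scaleN1r, scale0r).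
- by rewrite ib jb eqxx in ij.
- by rewrite (anti a j) 1?eq_sym //; ring.
- by rewrite (anti i a) //; ring.
by rewrite (anti i j) //; ring.
Qed.

Lemma dd_matrix_anticommuting : anticommuting dd_matrix.
Proof.
move=> i j ij; apply: endoP => -[u v]; congr pair; first exact: dd_corner.
exact: skewX_anti.
Qed.

End OddDividedDifference.

(** On the column [(0, 1)] the triangular matrix attached to [P] returns the divided difference of
    [P] together with [P] itself; see [nf_dd_matrix]. *)
HB.lock Definition odd_dd (k : fieldType) (n : nat) (a b : 'I_n) (P : {mpoly k[n]}) :=
  (nf (dd_matrix k a b) P (0, 1)).1.

Section OddDividedDifferenceTheory.
Variables (k : fieldType) (n : nat) (a b : 'I_n).
Implicit Types P Q : {mpoly k[n]}.
Local Notation V := {mpoly k[n]}.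
Local Notation X := (@skewX k n).
Local Notation D := (@odd_dd k n a b).

Lemma odd_ddE P : D P = (nf (dd_matrix k a b) P (0, 1)).1.
Proof. by rewrite unlock. Qed.

Lemma odd_dd_linear : linear D.
Proof. by move=> c P Q; rewrite !odd_ddE linearP. Qed.
Definition odd_dd_endo : endo {mpoly k[n]} := Endo odd_dd_linear.

Lemma odd_ddD P Q : D (P + Q) = D P + D Q. Proof. exact: (endoD odd_dd_endo). Qed.
Lemma odd_ddN P : D (- P) = - D P. Proof. exact: (endoN odd_dd_endo). Qed.
Lemma odd_ddB P Q : D (P - Q) = D P - D Q. Proof. exact: (endoB odd_dd_endo). Qed.
Lemma odd_dd0 : D 0 = 0. Proof. exact: (endo0 odd_dd_endo). Qed.

Lemma odd_dd1 : D 1 = 0.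
Proof. by rewrite odd_ddE nf1. Qed.

Hypothesis ab : a != b.

Lemma nf_dd_matrix P : nf (dd_matrix k a b) P (0, 1) = (D P, P).
Proof.
suff E : (nf (dd_matrix k a b) P (0, 1)).2 = P.
  by rewrite [LHS]surjective_pairing E odd_ddE.
elim/skewX_ind: P => [c P Q IP IQ||i P IP].
- by rewrite linearP /= IP IQ.
- by rewrite nf1.
- by rewrite (nf_skewX (dd_matrix_anticommuting k ab)) /= IP.
Qed.

Lemma odd_dd_skewX i P : D (X i P) = dd_twist a b i (D P) + dd_value k a b i *: P.
Proof.
rewrite odd_ddE (nf_skewX (dd_matrix_anticommuting k ab)) endoME.
by rewrite nf_dd_matrix.
Qed.

Lemma odd_dd_a P : D (X a P) = X b (D P) + P.
Proof. by rewrite odd_dd_skewX /dd_twist /dd_value eqxx scale1r. Qed.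
Lemma odd_dd_b P : D (X b P) = X a (D P) - P.
Proof.
by rewrite odd_dd_skewX /dd_twist /dd_value eq_sym (negPf ab) eqxx scaleN1r.
Qed.
Lemma odd_dd_other i P : i != a -> i != b -> D (X i P) = - X i (D P).
Proof.
move=> /negPf ia /negPf ib.
by rewrite odd_dd_skewX /dd_twist /dd_value ia ib scale0r addr0.
Qed.

End OddDividedDifferenceTheory.

(* The relations among the odd divided differences need no computation on
   polynomials: each relator maps 1 to 0, and its commutation with the x_i
   follows from the mixed relations. *)
Section DividedDifferenceRelations.
Variables (k : fieldType) (n : nat).
Implicit Types P Q : {mpoly k[n]}.
Local Notation V := {mpoly k[n]}.
Local Notation X := (@skewX k n).
Local Notation D := (@odd_dd k n).

Lemma skewX_relator0 (f : endo {mpoly k[n]}) : f 1 = 0 ->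
  (forall i P, f P = 0 -> f (X i P) = 0) -> f = 0.
Proof.
move=> f1 fX; apply: endoP => P; elim/skewX_ind: P => // a P Q fP fQ.
by rewrite endo_linear fP fQ scaler0 addr0.
Qed.

Lemma odd_dd_sqr (a b : 'I_n) : a != b -> odd_dd_endo k a b * odd_dd_endo k a b = 0.
Proof.
move=> ab; apply: skewX_relator0 => [|i P]; rewrite !endoME /=.
  by rewrite odd_dd1 odd_dd0.
move=> E; have [->|ia] := eqVneq i a.
  by rewrite odd_dd_a // odd_ddD odd_dd_b // E skewX0 sub0r addNr.
have [->|ib] := eqVneq i b.
  by rewrite odd_dd_b // odd_ddB odd_dd_a // E skewX0 add0r subrr.
by rewrite odd_dd_other // odd_ddN odd_dd_other // opprK E skewX0.
Qed.

Lemma odd_dd_far (a b c d : 'I_n) : a != b -> c != d -> a != c -> a != d -> b != c -> b != d ->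
  odd_dd_endo k a b * odd_dd_endo k c d = - (odd_dd_endo k c d * odd_dd_endo k a b).
Proof.
move=> ab cd ac ad bc bd; apply/eqP; rewrite -addr_eq0; apply/eqP.
apply: skewX_relator0 => [|i P]; rewrite !endoDE !endoME /=.
  by rewrite !odd_dd1 !odd_dd0 addr0.
set S := D a b _ + _ => E.
(* Pulling [x_i] out of the relator turns it, up to sign, into [x_j], with [j] the image of [i]
   under the two transpositions. Each goal is thus compared with a multiple of [S]. *)
have XE j : - X j S = 0 by rewrite E skewX0 oppr0.
have [ca da cb db] : [/\ c != a, d != a, c != b & d != b].
  by split; rewrite eq_sym.
have A (Q : V) : D a b (X a Q) = X b (D a b Q) + Q by exact: odd_dd_a.
have B (Q : V) : D a b (X b Q) = X a (D a b Q) - Q by exact: odd_dd_b.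
have C (Q : V) : D a b (X c Q) = - X c (D a b Q) by exact: odd_dd_other.
have C' (Q : V) : D a b (X d Q) = - X d (D a b Q) by exact: odd_dd_other.
have A1 (Q : V) : D c d (X c Q) = X d (D c d Q) + Q by exact: odd_dd_a.
have B1 (Q : V) : D c d (X d Q) = X c (D c d Q) - Q by exact: odd_dd_b.
have C1 (Q : V) : D c d (X a Q) = - X a (D c d Q) by exact: odd_dd_other.
have C1' (Q : V) : D c d (X b Q) = - X b (D c d Q) by exact: odd_dd_other.
have odd_ddE' := (odd_ddD, odd_ddB, odd_ddN, skewXD).
have [->|ia] := eqVneq i a.
  by rewrite -(XE b) /S !(A, B, C, C', A1, B1, C1, C1', odd_ddE'); ring.
have [->|ib] := eqVneq i b.
  by rewrite -(XE a) /S !(A, B, C, C', A1, B1, C1, C1', odd_ddE'); ring.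
have [->|ic] := eqVneq i c.
  by rewrite -(XE d) /S !(A, B, C, C', A1, B1, C1, C1', odd_ddE'); ring.
have [->|id] := eqVneq i d.
  by rewrite -(XE c) /S !(A, B, C, C', A1, B1, C1, C1', odd_ddE'); ring.
have O (Q : V) : D a b (X i Q) = - X i (D a b Q) by exact: odd_dd_other.
have O1 (Q : V) : D c d (X i Q) = - X i (D c d Q) by exact: odd_dd_other.
by rewrite -[RHS]oppr0 -(XE i) opprK /S !(O, O1, odd_ddE', opprK).
Qed.

Lemma odd_dd_braid (a b c : 'I_n) : a != b -> b != c -> a != c ->
  odd_dd_endo k a b * odd_dd_endo k b c * odd_dd_endo k a b =
  - (odd_dd_endo k b c * odd_dd_endo k a b * odd_dd_endo k b c).
Proof.
move=> ab bc ac; apply/eqP; rewrite -addr_eq0; apply/eqP.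
have ca : c != a by rewrite eq_sym. have cb : c != b by rewrite eq_sym.
apply: skewX_relator0 => [|i P]; rewrite !endoDE !endoME /=.
  by rewrite !odd_dd1 !odd_dd0 addr0.
set S := D a b _ + _ => E.
have XE j : - X j S = 0 by rewrite E skewX0 oppr0.
have A (Q : V) : D a b (X a Q) = X b (D a b Q) + Q by exact: odd_dd_a.
have B (Q : V) : D a b (X b Q) = X a (D a b Q) - Q by exact: odd_dd_b.
have C (Q : V) : D a b (X c Q) = - X c (D a b Q) by exact: odd_dd_other.
have A' (Q : V) : D b c (X a Q) = - X a (D b c Q) by exact: odd_dd_other.
have B' (Q : V) : D b c (X b Q) = X c (D b c Q) + Q by exact: odd_dd_a.
have C' (Q : V) : D b c (X c Q) = X b (D b c Q) - Q by exact: odd_dd_b.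
have s1 (Q : V) : D a b (D a b Q) = 0.
  by have := congr1 (fun f : endo {mpoly k[n]} => f Q) (odd_dd_sqr ab).
have s2 (Q : V) : D b c (D b c Q) = 0.
  by have := congr1 (fun f : endo {mpoly k[n]} => f Q) (odd_dd_sqr bc).
(* On either side the three transpositions compose to the exchange of [a] and [c]; this dictates the
   index given to [XE]. *)
have [->|ia] := eqVneq i a.
  rewrite -(XE c) /S !(A, B, C, A', B', C', odd_ddD, odd_ddB, odd_ddN, skewXD, s1, s2, skewX0).
  by ring.
have [->|ib] := eqVneq i b.
  rewrite -(XE b) /S !(A, B, C, A', B', C', odd_ddD, odd_ddB, odd_ddN, skewXD, s1, s2, skewX0).
  by ring.
have [->|ic] := eqVneq i c.
  rewrite -(XE a) /S !(A, B, C, A', B', C', odd_ddD, odd_ddB, odd_ddN, skewXD, s1, s2, skewX0).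
  by ring.
have O (Q : V) : D a b (X i Q) = - X i (D a b Q) by exact: odd_dd_other.
have O' (Q : V) : D b c (X i Q) = - X i (D b c Q) by exact: odd_dd_other.
by rewrite -(XE i) /S !(O, O', odd_ddN, skewXD); ring.
Qed.

End DividedDifferenceRelations.

Section PolynomialRepresentation.
Variables (k : fieldType) (n : nat).

Lemma ltn_predS (j : 'I_n.-1) : (j.+1 < n)%N.
Proof. by case: n j => [|m] [j]. Qed.

Definition ord_lo (j : 'I_n.-1) : 'I_n := Ordinal (ltnW (ltn_predS j)).
Definition ord_hi (j : 'I_n.-1) : 'I_n := Ordinal (ltn_predS j).

Definition tau_endo (j : 'I_n.-1) : endo {mpoly k[n]} := odd_dd_endo k (ord_lo j) (ord_hi j).

Lemma polynomial_representation : ONH_rel (@skewX_endo k n) tau_endo.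
Proof.
have lohi j : ord_lo j != ord_hi j by rewrite -val_eqE /= ltn_eqF.
do 5?[split].
- exact: skewX_anticommuting.
- move=> i j ij; apply: odd_dd_far => //; rewrite -val_eqE /=; lia.
- move=> i j ij ij1; apply: endoP => P.
  by rewrite endoNE !endoME /= odd_dd_other ?opprK // -val_eqE.
- by move=> j; apply: odd_dd_sqr.
- move=> j j' jj'.
  have E : ord_lo j' = ord_hi j by apply: val_inj.
  rewrite /tau_endo E; apply: odd_dd_braid; rewrite -?E // -val_eqE /= jj'; lia.
- move=> j i i' ij ij'.
  have -> : i = ord_lo j by apply: val_inj.
  have -> : i' = ord_hi j by apply: val_inj.
  split; apply: endoP => P; rewrite endoDE endoNE !endoME /=.
    by rewrite odd_dd_b // opprB addrC subrK.
  by rewrite odd_dd_a // addrC addKr.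
Qed.

End PolynomialRepresentation.

(** * Spans of words *)

Section WordSpan.
Variables (k : fieldType) (A : algType k) (I : Type) (g : I -> A).
Implicit Types (P : pred (seq I)) (z : A).

Lemma in_word_span0 P : in_word_span g P 0.
Proof. by exists [::]; rewrite big_nil. Qed.

Lemma in_word_span_word P w : P w -> in_word_span g P (\prod_(i <- w) g i).
Proof. by move=> Pw; exists [:: (1, w)]; rewrite big_seq1 scale1r /= Pw. Qed.

Lemma in_word_span1 P : P [::] -> in_word_span g P 1.
Proof. by move=> /in_word_span_word; rewrite big_nil. Qed.

Lemma in_word_span_gen P i : P [:: i] -> in_word_span g P (g i).
Proof. by move=> /in_word_span_word; rewrite big_seq1. Qed.

Lemma in_word_span_linear P (a : k) z z' :
  in_word_span g P z -> in_word_span g P z' -> in_word_span g P (a *: z + z').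
Proof.
move=> [s [-> Ps]] [s' [-> Ps']].
exists ([seq (a * p.1, p.2) | p <- s] ++ s'); split; last by rewrite all_cat all_map Ps.
rewrite big_cat big_map scaler_sumr; congr (_ + _).
by apply: eq_bigr => p _; rewrite scalerA.
Qed.

Lemma in_word_span_ind P (Q : A -> Prop) : Q 0 ->
    (forall a z z', Q z -> Q z' -> Q (a *: z + z')) ->
    (forall w, P w -> Q (\prod_(i <- w) g i)) ->
  forall z, in_word_span g P z -> Q z.
Proof.
move=> Q0 QD QP z [s [->]]; elim: s => [|p s IHs] /=; first by rewrite big_nil.
by case/andP=> /QP Qp /IHs Qs; rewrite big_cons; apply: QD.
Qed.

Lemma in_word_spanZ P a z : in_word_span g P z -> in_word_span g P (a *: z).
Proof. by move=> Pz; rewrite -[_ *: _]addr0; apply/in_word_span_linear/in_word_span0. Qed.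

Lemma in_word_spanD P z z' :
  in_word_span g P z -> in_word_span g P z' -> in_word_span g P (z + z').
Proof. by rewrite -{2}[z]scale1r; apply: in_word_span_linear. Qed.

Lemma in_word_spanN P z : in_word_span g P z -> in_word_span g P (- z).
Proof. by rewrite -scaleN1r; apply: in_word_spanZ. Qed.

Lemma in_word_span_mul P1 P2 P z1 z2 :
    (forall w1 w2, P1 w1 -> P2 w2 -> P (w1 ++ w2)) ->
  in_word_span g P1 z1 -> in_word_span g P2 z2 -> in_word_span g P (z1 * z2).
Proof.
move=> PP Pz1 Pz2; elim/in_word_span_ind: Pz1 => [|a u v Hu Hv|w1 Pw1].
- by rewrite mul0r; apply: in_word_span0.
- by rewrite mulrDl -scalerAl; apply: in_word_span_linear.
elim/in_word_span_ind: Pz2 => [|a u v Hu Hv|w2 Pw2].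
- by rewrite mulr0; apply: in_word_span0.
- by rewrite mulrDr -scalerAr; apply: in_word_span_linear.
by rewrite -big_cat; apply/in_word_span_word/PP.
Qed.

Lemma in_word_span_sub P P' z : (forall w, P w -> P' w) ->
  in_word_span g P z -> in_word_span g P' z.
Proof.
move=> PP'; elim/in_word_span_ind => [|a u v Hu Hv|w /PP'].
- exact: in_word_span0.
- exact: in_word_span_linear.
- exact: in_word_span_word.
Qed.

End WordSpan.

Definition parity (I : Type) (b : bool) : pred (seq I) := fun w => odd (size w) == b.

(** * Symmetric elements of the skew polynomial algebra *)

Lemma filter_index_enum_set (T : finType) (S : {set T}) :
  [seq i <- index_enum T | i \in S] = enum S.
Proof. by rewrite [index_enum T]unlock. Qed.

Lemma prod_addr_comm (R : nzRingType) (n : nat) (u : 'I_n -> R) (W : R) :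
    (forall i, GRing.comm (u i) W) ->
  \prod_(i < n) (W + u i) =
  \sum_(S : {set 'I_n}) (\prod_(i <- enum S) u i) * W ^+ (n - #|S|).
Proof.
move=> cW; under eq_bigr do rewrite addrC.
rewrite (bigA_distr 1 +%R) /=; apply: eq_bigr => S _.
have -> : (n - #|S|)%N = count (predC (mem S)) (index_enum 'I_n).
  have := count_predC (mem S) (index_enum 'I_n).
  have -> : size (index_enum 'I_n) = n by rewrite /index_enum -enumT size_enum_ord.
  by rewrite -size_filter filter_index_enum_set -cardE => /(canRL (addKn _)).
rewrite -filter_index_enum_set; elim: (index_enum _) => [|i s IHs] /=.
  by rewrite !big_nil mulr1.
rewrite big_cons IHs; case: (i \in S) => /=; first by rewrite big_cons mulrA.
rewrite add1n exprS !mulrA; congr (_ * _).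
by apply: commr_prod => j _; apply: commr_sym.
Qed.

(** The opposite ring [R^c] turns an ordered product into the reversed one, so the previous
    expansion applies there. *)
Lemma prod_rev_addr_comm (R : nzRingType) (n : nat) (u : 'I_n -> R) (W : R) :
    (forall i, GRing.comm (u i) W) ->
  \prod_(i <- rev (index_enum 'I_n)) (W + u i) =
  \sum_(S : {set 'I_n}) (\prod_(i <- rev (enum S)) u i) * W ^+ (n - #|S|).
Proof.
move=> cW; rewrite -rev_prodr (@prod_addr_comm R^c) => [|i]; last exact/commr_sym/cW.
apply: eq_bigr => S _; rewrite rev_prodr.
have cS : GRing.comm (W ^+ (n - #|S|)) (\prod_(i <- rev (enum S)) u i).
  by apply/commr_prod => i _; apply/commr_sym/commrX.
rewrite -[RHS]cS; congr (_ * _ : R).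
by elim: (n - _)%N => // e IHe; rewrite exprS exprSr; congr (_ * _ : R).
Qed.

Lemma sum_set_card (R : nmodType) (n : nat) (F : {set 'I_n} -> R) :
  \sum_S F S = \sum_(r < n.+1) \sum_(S : {set 'I_n} | #|S| == r) F S.
Proof.
rewrite (partition_big (fun S : {set 'I_n} => inord #|S| : 'I_n.+1) predT) //=.
apply: eq_bigr => r _; apply: eq_bigl => S.
by rewrite -val_eqE /= inordK // ltnS -[n in (_ <= n)%N]card_ord max_card.
Qed.

(** Generating function of the odd elementary symmetric polynomials. The ring map [f] lets [W] be a
    polynomial variable or a matrix over [A]. *)
Lemma prod_oelem (k : fieldType) (A : algType k) (n : nat) (x : 'I_n -> A)
    (R : nzRingType) (f : {rmorphism A -> R}) (W : R) :
    (forall i, GRing.comm (f (x i)) W) ->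
  \prod_(i < n) (W + f (x i)) = \sum_(r < n.+1) f (oelem x r) * W ^+ (n - r).
Proof.
move=> cW; rewrite prod_addr_comm // sum_set_card; apply: eq_bigr => r _.
rewrite /oelem rmorph_sum mulr_suml.
by apply: eq_bigr => S /eqP ->; rewrite rmorph_prod.
Qed.

(* Multiplying by the product of the conjugates in reverse order telescopes,
   because the elements W^2 - u_i^2 are central. *)
Lemma prod_conjugates (R : pzRingType) (I : Type) (u : I -> R) (W : R) (s : seq I) :
    (forall i, GRing.comm (u i) W) -> (forall i j, GRing.comm (u i ^+ 2) (u j)) ->
  (\prod_(i <- s) (W + u i)) * (\prod_(i <- rev s) (W - u i)) =
    \prod_(i <- s) (W ^+ 2 - u i ^+ 2) /\
  (\prod_(i <- rev s) (W - u i)) * (\prod_(i <- s) (W + u i)) =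
    \prod_(i <- s) (W ^+ 2 - u i ^+ 2).
Proof.
move=> cW cu.
have cD i j : GRing.comm (W ^+ 2 - u i ^+ 2) (u j).
  by apply: commr_sym; apply: commrB; [apply: commrX | apply: commr_sym].
have cDW i : GRing.comm (W ^+ 2 - u i ^+ 2) W.
  by apply: commr_sym; apply: commrB; [apply: commrX | apply/commrX/commr_sym].
have [E1 E2] : (forall i, (W + u i) * (W - u i) = W ^+ 2 - u i ^+ 2) /\
    (forall i, (W - u i) * (W + u i) = W ^+ 2 - u i ^+ 2).
  split=> i; first by rewrite mulrDl !mulrBr cW addrA subrK -!expr2.
  by rewrite mulrBl !mulrDr cW opprD addrA addrK -!expr2.
elim: s => [|a s [IH1 IH2]]; first by rewrite !big_nil mulr1.
rewrite rev_cons -cats1 big_cat big_seq1 /= !big_cons; split.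
  rewrite mulrA -[_ * _ * \prod_(i <- rev s) _]mulrA IH1.
  have cP : GRing.comm (W - u a) (\prod_(i <- s) (W ^+ 2 - u i ^+ 2)).
    by apply: commr_prod => i _; apply/commr_sym/commrB.
  by rewrite -mulrA -cP mulrA E1.
have cP : GRing.comm (W ^+ 2 - u a ^+ 2) (\prod_(i <- rev s) (W - u i)).
  by apply: commr_prod => i _; apply: commrB.
by rewrite mulrA -[_ * _ * (W + u a)]mulrA E2 -cP -mulrA IH2.
Qed.

(** * Consequences of the odd nilHecke relations *)

Lemma enum_ord_split2 (n : nat) (a b : 'I_n) : b = a.+1 :> nat ->
  exists s s', index_enum 'I_n = s ++ [:: a, b & s'].
Proof.
move=> ba; exists (take a (enum 'I_n)), (drop b.+1 (enum 'I_n)).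
rewrite /index_enum -enumT -[LHS](cat_take_drop a) (drop_nth a) ?size_enum_ord //.
by rewrite nth_ord_enum -ba (drop_nth b) ?size_enum_ord // nth_ord_enum.
Qed.

Section Relations.
Variables (k : fieldType) (n : nat) (A : algType k).
Variables (x : 'I_n -> A) (t : 'I_n.-1 -> A).
Hypothesis rel : ONH_rel x t.

Lemma x_anticommuting : anticommuting x.
Proof. exact: rel.1. Qed.

Lemma tau_far (i j : 'I_n.-1) : (i.+1 < j)%N || (j.+1 < i)%N -> t i * t j = - (t j * t i).
Proof. exact: rel.2.1. Qed.

Lemma tau_x_other (i : 'I_n) j : i != ord_lo j -> i != ord_hi j -> t j * x i = - (x i * t j).
Proof.
by rewrite -!val_eqE => ij ij'; rewrite rel.2.2.1 // opprK.
Qed.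

Lemma tau_sqr j : t j * t j = 0.
Proof. exact: rel.2.2.2.1. Qed.

Lemma tau_braid (j j' : 'I_n.-1) : j' = j.+1 :> nat -> t j * t j' * t j = - (t j' * t j * t j').
Proof. exact: rel.2.2.2.2.1. Qed.

Lemma tau_x_lo j : t j * x (ord_lo j) = 1 + x (ord_hi j) * t j.
Proof.
have [_ <-] := rel.2.2.2.2.2 j (ord_lo j) (ord_hi j) erefl erefl.
by rewrite subrK.
Qed.

Lemma tau_x_hi j : t j * x (ord_hi j) = x (ord_lo j) * t j - 1.
Proof.
have [<- _] := rel.2.2.2.2.2 j (ord_lo j) (ord_hi j) erefl erefl.
by rewrite opprB addrC subrK.
Qed.

Lemma x_sqr_comm i j : GRing.comm (x i ^+ 2) (x j).
Proof.
have [->|ij] := eqVneq i j; first exact/commr_sym/commrX.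
by rewrite /GRing.comm expr2 -mulrA x_anticommuting // mulrN mulrA x_anticommuting // mulNr opprK mulrA.
Qed.

(** The constants of [tau_x_lo] and [tau_x_hi] cancel. Together with [tau_x_prod] this carries [t j]
    through [(T + x_lo) (T + x_hi)], for central [T], at the cost of exchanging the two factors. *)
Lemma tau_x_sum j : t j * (x (ord_lo j) + x (ord_hi j)) =
  (x (ord_hi j) + x (ord_lo j)) * t j.
Proof. by rewrite mulrDr tau_x_lo tau_x_hi mulrDl addrC addrA subrK addrC. Qed.

Lemma tau_x_prod j : t j * (x (ord_lo j) * x (ord_hi j)) =
  x (ord_hi j) * x (ord_lo j) * t j.
Proof.
rewrite mulrA tau_x_lo mulrDl mul1r -mulrA tau_x_hi mulrBr mulr1 mulrA.
by rewrite addrC subrK.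
Qed.

(** [t j] crosses the generating function [prod_i (T + x_i)]: the two factors at [j] are exchanged
    and every other [T + x_i] becomes [T - x_i]. The claim follows by comparing coefficients. *)
Lemma tau_oelem j r : exists b, t j * oelem x r = b * t j.
Proof.
have commX (i : 'I_n) : GRing.comm (x i)%:P ('X : {poly A}) by exact: commr_polyX.
have EP := prod_oelem (f := polyC) (x := x) commX.
have [s [s' Es]] := @enum_ord_split2 n (ord_lo j) (ord_hi j) erefl.
have : uniq (s ++ [:: ord_lo j, ord_hi j & s']) by rewrite -Es index_enum_uniq.
rewrite cat_uniq /= negb_or negb_or !inE negb_or.
case/and3P=> _ /and3P[sl sh _] /and3P[/andP[lh ls'] hs' _].
have other (q : seq 'I_n) : {in q, forall i, i != ord_lo j} -> {in q, forall i, i != ord_hi j} ->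
    exists F, (t j)%:P * \prod_(i <- q) ('X + (x i)%:P) = F * (t j)%:P :> {poly A}.
  elim: q => [|i q IHq] ql qh; first by exists 1; rewrite big_nil mulr1 mul1r.
  have [F EF] := IHq (fun l lq => ql l (@mem_behead _ (i :: q) l lq))
    (fun l lq => qh l (@mem_behead _ (i :: q) l lq)).
  exists (('X - (x i)%:P) * F); rewrite big_cons mulrA mulrDr -polyCM tau_x_other;
    try by [apply: ql; rewrite inE eqxx | apply: qh; rewrite inE eqxx].
  by rewrite -mulrA -EF mulrA mulrBl polyCN polyCM commr_polyX.
have neq (q : seq 'I_n) (c : 'I_n) : c \notin q -> {in q, forall i, i != c}.
  by move=> cq i; apply: contraTneq => ->.
have [F EF] := other s (neq _ _ sl) (neq _ _ sh).
have [F' EF'] := other s' (neq _ _ ls') (neq _ _ hs').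
have XX (a b : A) : ('X + a%:P) * ('X + b%:P) = 'X * 'X + 'X * (a + b)%:P + (a * b)%:P.
  by rewrite mulrDl !mulrDr polyCD polyCM mulrDr -(commr_polyX a%:P) !addrA (addrAC ('X * 'X)).
have EM : (t j)%:P * (('X + (x (ord_lo j))%:P) * ('X + (x (ord_hi j))%:P)) =
    ('X + (x (ord_hi j))%:P) * ('X + (x (ord_lo j))%:P) * (t j)%:P :> {poly A}.
  rewrite !XX !mulrDr !mulrDl; congr (_ + _ + _).
  - by rewrite mulrA (commr_polyX (t j)%:P) -mulrA (commr_polyX (t j)%:P) mulrA.
  - by rewrite mulrA (commr_polyX (t j)%:P) -!mulrA -!polyCM tau_x_sum.
  - by rewrite -!polyCM tau_x_prod.
have E : (t j)%:P * \prod_i ('X + (x i)%:P) =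
    F * ('X + (x (ord_hi j))%:P) * ('X + (x (ord_lo j))%:P) * F' * (t j)%:P :> {poly A}.
  rewrite Es big_cat !big_cons mulrA EF -!mulrA; congr (F * _).
  by rewrite -EF' !mulrA -EM !mulrA.
(* As [i] and [r] are at most [n], degree [n - r] isolates the term [i = r]. *)
move: E; rewrite EP => /(congr1 (fun p : {poly A} => p`_(n - r))).
rewrite coefCM coefMC coef_sum (bigD1 r) //= big1 => [|i ir]; last first.
  rewrite coefCM coefXn; case: eqP => [E|]; last by rewrite mulr0.
  case/negP: ir; rewrite -val_eqE /=; have := ltn_ord i; have := ltn_ord r; lia.
by rewrite addr0 coefCM coefXn eqxx mulr1 => ->; eexists.
Qed.

End Relations.

(** * Reduction modulo the left ideal generated by the tau_j *)

Section LeftIdeal.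
Variables (k : fieldType) (n : nat) (A : algType k).
Variables (x : 'I_n -> A) (t : 'I_n.-1 -> A).
Hypothesis rel : ONH_rel x t.

(** [t j] crosses the letters one by one; the constants in the mixed relations delete a letter,
    whence the opposite parity of [f]. *)
Lemma tau_xword j w : exists f b,
  in_word_span x (parity (~~ odd (size w))) f /\ t j * \prod_(i <- w) x i = f + b * t j.
Proof.
elim: w => [|i w [f [b [Hf E]]]].
  by exists 0, 1; rewrite big_nil mulr1 mul1r add0r; split=> //; apply: in_word_span0.
have Hx l : in_word_span x (parity (~~ odd (size (i :: w)))) (x l * f).
  have Hl : in_word_span x (parity true) (x l).
    exact: in_word_span_gen.
  apply: (in_word_span_mul _ Hl Hf) => w1 w2 /eqP o1 /eqP o2.
  by rewrite /parity size_cat oddD o1 o2.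
have Hw : in_word_span x (parity (~~ odd (size (i :: w)))) (\prod_(i <- w) x i).
  by apply: in_word_span_word; rewrite /parity /= negbK.
rewrite big_cons mulrA; have [->|il] := eqVneq i (ord_lo j).
  exists (\prod_(i <- w) x i + x (ord_hi j) * f), (x (ord_hi j) * b); split.
    exact: in_word_spanD.
  by rewrite (tau_x_lo rel) mulrDl mul1r -[x _ * t j * _]mulrA E mulrDr mulrA addrA.
have [->|ih] := eqVneq i (ord_hi j).
  exists (x (ord_lo j) * f - \prod_(i <- w) x i), (x (ord_lo j) * b); split.
    by apply/in_word_spanD/in_word_spanN.
  by rewrite (tau_x_hi rel) mulrBl mul1r -[x _ * t j * _]mulrA E mulrDr mulrA addrAC.
exists (- (x i * f)), (- (x i * b)); split; first exact: in_word_spanN.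
by rewrite (tau_x_other rel) // !mulNr -[x _ * t j * _]mulrA E mulrDr opprD mulrA.
Qed.

(** A letter [t j] in front of a skew polynomial either reaches the right end or disappears together
    with one [x]. Parity is kept because both lost letters are odd. *)
Lemma skew_part p z : in_word_span (ONH_gen x t) (parity p) z ->
  exists f (b : 'I_n.-1 -> A), in_word_span x (parity p) f /\ z = f + \sum_j b j * t j.
Proof.
elim/in_word_span_ind => [|a z1 z2 [f1 [b1 [H1 ->]]] [f2 [b2 [H2 ->]]]|w /eqP <-].
- exists 0, (fun=> 0); split; first exact: in_word_span0.
  by rewrite big1 ?addr0 // => j _; rewrite mul0r.
- exists (a *: f1 + f2), (fun j => a *: b1 j + b2 j); split; first exact: in_word_span_linear.
  rewrite scalerDr scaler_sumr addrACA -big_split; congr (_ + _).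
  by apply: eq_bigr => j _; rewrite /= mulrDl scalerAl.
elim: w => [|[i|j] w [f [b [Hf E]]]] /=.
- exists 1, (fun=> 0); rewrite big_nil big1 ?addr0 => [|j _]; last by rewrite mul0r.
  by split=> //; apply: in_word_span1.
- exists (x i * f), (fun j => x i * b j); rewrite big_cons E mulrDr mulr_sumr; split.
    have Hl : in_word_span x (parity true) (x i).
      exact: in_word_span_gen.
    apply: (in_word_span_mul _ Hl Hf) => w1 w2 /eqP o1 /eqP o2.
    by rewrite /parity size_cat oddD o1 o2.
  by congr (_ + _); apply: eq_bigr => l _; rewrite mulrA.
rewrite big_cons E mulrDr mulr_sumr /=.
have [f' [b' [Hf' ->]]] : exists f' b',
    in_word_span x (parity (~~ odd (size w))) f' /\ t j * f = f' + b' * t j.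
  elim/in_word_span_ind: Hf => [|a u v [fu [bu [Hu Eu]]] [fv [bv [Hv Ev]]]|v /eqP <-].
  - by exists 0, 0; rewrite mulr0 mul0r addr0; split=> //; apply: in_word_span0.
  - exists (a *: fu + fv), (a *: bu + bv); split; first exact: in_word_span_linear.
    by rewrite mulrDr -scalerAr Eu Ev scalerDr addrACA mulrDl scalerAl.
  exact: tau_xword.
exists f', (fun l => (if l == j then b' else 0) + t j * b l); split=> //.
rewrite -addrA; congr (_ + _).
under [RHS]eq_bigr do rewrite mulrDl.
rewrite big_split /=; congr (_ + _).
  rewrite (bigD1 j) //= eqxx big1 ?addr0 // => l /negPf ->.
  by rewrite mul0r.
by apply: eq_bigr => l _; rewrite mulrA.
Qed.

End LeftIdeal.

(** * Skew polynomials inside ONH_n and their action *)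

Section Represented.
Variables (k : fieldType) (n : nat) (A : algType k).
Variables (x : 'I_n -> A) (t : 'I_n.-1 -> A).
Hypothesis rel : ONH_rel x t.
Variable phi : A -> endo {mpoly k[n]}.
Hypothesis phi_hom : alg_hom phi.
Hypothesis phi_x : forall i, phi (x i) = skewX_endo k i.
Hypothesis phi_t : forall j, phi (t j) = tau_endo k j.
Local Notation V := {mpoly k[n]}.
Local Notation X := (@skewX k n).

Definition skew_act (z : A) (P : V) : V := phi z P.

Lemma skew_actM z z' P : skew_act (z * z') P = skew_act z (skew_act z' P).
Proof. by rewrite /skew_act; case: phi_hom => _ -> _. Qed.
Lemma skew_act_linear a z z' P : skew_act (a *: z + z') P = a *: skew_act z P + skew_act z' P.
Proof. by rewrite /skew_act; case: phi_hom => -> _ _. Qed.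
Lemma skew_act1 P : skew_act 1 P = P.
Proof. by rewrite /skew_act; case: phi_hom => _ _ ->. Qed.
Lemma skew_actD z z' P : skew_act (z + z') P = skew_act z P + skew_act z' P.
Proof. by rewrite -[z]scale1r skew_act_linear !scale1r. Qed.
Lemma skew_act0 P : skew_act 0 P = 0.
Proof. by apply: (addrI (skew_act 0 P)); rewrite -skew_actD !addr0. Qed.
Lemma skew_actZ a z P : skew_act (a *: z) P = a *: skew_act z P.
Proof. by rewrite -[_ *: z]addr0 skew_act_linear skew_act0 addr0. Qed.
Lemma skew_actN z P : skew_act (- z) P = - skew_act z P.
Proof. by rewrite -!scaleN1r skew_actZ. Qed.
Lemma skew_actB z z' P : skew_act (z - z') P = skew_act z P - skew_act z' P.
Proof. by rewrite skew_actD skew_actN. Qed.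
Lemma skew_act_sum (I : Type) (r : seq I) (F : I -> A) P :
  skew_act (\sum_(i <- r) F i) P = \sum_(i <- r) skew_act (F i) P.
Proof. exact: (big_morph (fun z => skew_act z P) (fun z z' => skew_actD z z' P) (skew_act0 P)). Qed.
Lemma skew_act_r0 z : skew_act z 0 = 0.
Proof. exact: endo0. Qed.
Lemma skew_act_x i P : skew_act (x i) P = X i P.
Proof. by rewrite /skew_act phi_x. Qed.
Lemma skew_act_t1 j : skew_act (t j) 1 = 0.
Proof. by rewrite /skew_act phi_t; apply: odd_dd1. Qed.

Definition skew_poly (f : A) : Prop := exists P, f = nf x P.

Lemma x_nf i P : x i * nf x P = nf x (X i P).
Proof. by rewrite nf_skewX //; apply: x_anticommuting rel. Qed.

(** Acting on 1 recovers the normal form, so a skew polynomial can be tested for vanishing on the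
    single vector 1. *)
Lemma skew_act_nf P : skew_act (nf x P) 1 = P.
Proof.
elim/skewX_ind: P => [a P Q IP IQ||i P IP].
- by rewrite linearP skew_act_linear IP IQ.
- by rewrite nf1 skew_act1.
- by rewrite -x_nf skew_actM skew_act_x IP.
Qed.

Lemma skew_poly_eq0 f : skew_poly f -> skew_act f 1 = 0 -> f = 0.
Proof. by case=> P ->; rewrite skew_act_nf => ->; rewrite linear0. Qed.

Lemma skew_poly_linear a f g : skew_poly f -> skew_poly g -> skew_poly (a *: f + g).
Proof. by case=> P -> [Q ->]; exists (a *: P + Q); rewrite linearP. Qed.
Lemma skew_polyB f g : skew_poly f -> skew_poly g -> skew_poly (f - g).
Proof. by case=> P -> [Q ->]; exists (P - Q); rewrite linearB. Qed.
Lemma skew_poly1 : skew_poly 1.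
Proof. by exists 1; rewrite nf1. Qed.
Lemma skew_poly_xM i f : skew_poly f -> skew_poly (x i * f).
Proof. by case=> P ->; exists (X i P); rewrite x_nf. Qed.
Lemma skew_polyM f g : skew_poly f -> skew_poly g -> skew_poly (f * g).
Proof.
case=> P -> sg; elim/skewX_ind: P => [a P Q IP IQ||i P IP].
- by rewrite linearP mulrDl -scalerAl; apply: skew_poly_linear.
- by rewrite nf1 mul1r.
- by rewrite -x_nf -mulrA; apply: skew_poly_xM.
Qed.
Lemma skew_poly_x i : skew_poly (x i).
Proof. by rewrite -[x i]mulr1; apply/skew_poly_xM/skew_poly1. Qed.

Lemma in_word_span_skew_poly p f : in_word_span x p f -> skew_poly f.
Proof.
elim/in_word_span_ind => [||w _]; first by exists 0; rewrite linear0.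
  exact: skew_poly_linear.
elim: w => [|i w IHw]; first by rewrite big_nil; apply: skew_poly1.
by rewrite big_cons; apply: skew_poly_xM.
Qed.

Lemma oelem_skew_poly r : skew_poly (oelem x r).
Proof.
apply: (@in_word_span_skew_poly predT); rewrite /oelem.
elim/big_rec: _ => [|S z _ Hz]; first exact: in_word_span0.
by apply: in_word_spanD => //; apply: in_word_span_word.
Qed.

Lemma in_OSym_skew_poly z : in_OSym x z -> skew_poly z.
Proof.
elim/in_word_span_ind => [||w _]; first by exists 0; rewrite linear0.
  exact: skew_poly_linear.
elim: w => [|i w IHw]; first by rewrite big_nil; apply: skew_poly1.
by rewrite big_cons; apply: skew_polyM => //; apply: oelem_skew_poly.
Qed.

Lemma skew_act_x_sqr i P : skew_act (x i ^+ 2) P = 'X_i ^+ 2 * P.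
Proof. by rewrite expr2 skew_actM !skew_act_x skewX_sqr. Qed.

Lemma mpolyX2_coeff (i l : 'I_n) : ('X_l ^+ 2 : V)@_(U_(i) *+ 2) = (l == i)%:R.
Proof.
rewrite mpolyXn mcoeffX; congr (nat_of_bool _)%:R.
apply/eqP/eqP => [|-> //] /mnmP/(_ i); rewrite !mulmnE !mnm1E eqxx mul1n.
by case: eqP.
Qed.

(** The square of [x i] acts as multiplication by ['X_i ^+ 2], and [{mpoly k[n]}] is a domain. The
    scalar [a] covers both sums and differences of squares. *)
Lemma skew_poly_torsion_free i l (a : k) f : i != l -> skew_poly f ->
  (x i ^+ 2 + a *: x l ^+ 2) * f = 0 -> f = 0.
Proof.
move=> il sf E; apply: skew_poly_eq0 => //.
have : ('X_i ^+ 2 + a *: 'X_l ^+ 2) * skew_act f 1 = 0.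
  by rewrite mulrDl -scalerAl -!skew_act_x_sqr -!skew_actM -skew_actZ -skew_actD scalerAl -mulrDl E skew_act0.
move/eqP; rewrite mulf_eq0 => /orP[/eqP H|/eqP //].
have /eqP := congr1 (mcoeff (U_(i) *+ 2)) H.
by rewrite mcoeffD mcoeffZ !mpolyX2_coeff eqxx [l == i]eq_sym (negPf il) mulr0 addr0 mcoeff0 oner_eq0.
Qed.

Lemma x_sqr_skew_comm i f : skew_poly f -> GRing.comm (x i ^+ 2) f.
Proof.
case=> P ->; elim/skewX_ind: P => [a P Q IP IQ||l P IP].
- by rewrite linearP; apply: commrD => //; rewrite /GRing.comm -scalerAr IP scalerAl.
- by rewrite nf1; apply: commr1.
- by rewrite -x_nf; apply: commrM => //; apply: x_sqr_comm rel _ _.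
Qed.

Lemma skew_poly_prod_torsion_free i (s : seq 'I_n) f : i \notin s -> skew_poly f ->
  (\prod_(l <- s) (x i ^+ 2 - x l ^+ 2)) * f = 0 -> f = 0.
Proof.
move=> + sf; elim: s => [|l s IHs]; first by rewrite big_nil mul1r.
rewrite inE negb_or big_cons -mulrA => /andP[il is_] /= E; apply: IHs => //.
have sp : skew_poly (\prod_(l <- s) (x i ^+ 2 - x l ^+ 2)).
  elim/big_rec: _ => [|l' z _ sz]; first exact: skew_poly1.
  by apply: skew_polyM => //; apply: skew_polyB; apply: skew_polyM; apply: skew_poly_x.
apply: (skew_poly_torsion_free (a := -1) il); first exact: skew_polyM.
by rewrite scaleN1r.
Qed.

(* Over the extension by a central square root W of x_i^2, the elements
   W - x_i and W + x_i annihilate each other, while the other factors of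
   prod_l (W + x_l) divide nonzero central elements.  An f that commutes with
   this product then satisfies (W - x_i) f (W + x_i) = 0; the coefficient of W
   is [f, x_i].  The extension is realised by 2 x 2 matrices. *)
Lemma comm_oelem_comm_x f : skew_poly f -> (forall r, GRing.comm f (oelem x r)) ->
  forall i, GRing.comm f (x i).
Proof.
move=> sf cf.
(* Induction over prefixes of the list of variables: [f] already commutes with the factors preceding
   [W + x_i], which allows them to be cancelled on the left. *)
suff H s1 s2 : index_enum 'I_n = s1 ++ s2 -> forall i, i \in s1 -> GRing.comm f (x i).
  by move=> i; apply: (H (index_enum 'I_n) [::]); rewrite ?cats0 ?mem_index_enum.
elim/last_ind: s1 s2 => // s1 i IHs s2; rewrite cat_rcons => Es.
have {}IHs l : l \in s1 -> GRing.comm f (x l) by exact: IHs Es l.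
suff fi : GRing.comm f (x i) by move=> l; rewrite mem_rcons inE => /orP[/eqP ->|/IHs].
have [is1 is2] : i \notin s1 /\ i \notin s2.
  have := index_enum_uniq 'I_n; rewrite Es cat_uniq /= negb_or.
  by case/and3P=> _ /andP[-> _] /andP[-> _].
(* [W] is the companion matrix of [T^2 - y]; it commutes with [io a] as soon as [a] commutes with
   [y]. *)
pose y := x i ^+ 2; pose W : 'M[A]_2 := \matrix_(a, b) (if a == b then 0 else if a == 0 then y else 1).
pose io : A -> 'M[A]_2 := scalar_mx.
have ioM a b : io (a * b) = io a * io b by exact: scalar_mxM.
have ioB a b : io (a - b) = io a - io b by exact: raddfB.
have comm_io a b : GRing.comm a b -> GRing.comm (io a) (io b).
  by rewrite /GRing.comm -!ioM => ->.
have comm_W a : GRing.comm y a -> GRing.comm (io a) W.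
  move=> ya; rewrite /GRing.comm; apply/matrixP => p q.
  rewrite -[io a * W]/(a%:M *m W) -[W * io a]/(W *m a%:M) mul_scalar_mx !mxE.
  rewrite (bigD1 q) //= big1 ?addr0 => [|r rq]; last by rewrite !mxE (negPf rq) mulr0n mulr0.
  rewrite !mxE eqxx mulr1n; case: ifP => _; first by rewrite mulr0 mul0r.
  by case: ifP => _; [exact: esym | rewrite mulr1 mul1r].
have WW : W ^+ 2 = io y.
  rewrite expr2; apply/matrixP => p q; rewrite -[W * W]/(W *m W) !mxE !big_ord_recl big_ord0 !mxE /=.
  by case: p => [[|[|//]] ?]; case: q => [[|[|//]] ?]; rewrite /= ?mxE ?mul0r ?mulr0 ?mul1r ?mulr1 ?add0r ?addr0.
pose u l := io (x l); pose F := io f.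
have uW l : GRing.comm (u l) W by apply/comm_W/(x_sqr_comm rel).
have uu l l' : GRing.comm (u l ^+ 2) (u l').
  by rewrite /u expr2 -ioM -expr2; apply/comm_io/(x_sqr_comm rel).
have FW : GRing.comm F W by apply/comm_W/x_sqr_skew_comm.
have Eall : GRing.comm F (\prod_(l < n) (W + u l)).
  rewrite (prod_oelem (f := io)) //; apply: commr_sum => r _; apply: commrM.
    exact/comm_io/cf.
  exact: commrX.
pose P := \prod_(l <- s1) (W + u l); pose P' := \prod_(l <- rev s1) (W - u l).
pose G := \prod_(l <- s2) (W + u l); pose G' := \prod_(l <- rev s2) (W - u l).
pose c1 := \prod_(l <- s1) (y - x l ^+ 2); pose c2 := \prod_(l <- s2) (y - x l ^+ 2).
have ioprod s : \prod_(l <- s) (W ^+ 2 - u l ^+ 2) = io (\prod_(l <- s) (y - x l ^+ 2)).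
  by rewrite /io rmorph_prod; apply: eq_bigr => l _; rewrite rmorphB WW /u expr2 -ioM -expr2.
have PP : P' * P = io c1 by have [_ ->] := prod_conjugates s1 uW uu.
have GG : G * G' = io c2 by have [-> _] := prod_conjugates s2 uW uu.
have FP : GRing.comm F P.
  rewrite /P big_seq; apply: commr_prod => l /IHs fl; apply: commrD => //.
  exact: comm_io.
have skc s : skew_poly (\prod_(l <- s) (y - x l ^+ 2)).
  elim/big_rec: _ => [|l z _ sz]; first exact: skew_poly1.
  by apply: skew_polyM => //; apply: skew_polyB; apply: skew_polyM; apply: skew_poly_x.
have comm_c s g : skew_poly g -> GRing.comm g (\prod_(l <- s) (y - x l ^+ 2)).
  move=> sg; apply: commr_prod => l _; apply: commrB; exact/commr_sym/x_sqr_skew_comm.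
have cW s : GRing.comm (io (\prod_(l <- s) (y - x l ^+ 2))) W.
  exact/comm_W/x_sqr_skew_comm.
(* The commutation of [F] with the full product is multiplied by [P'] and [W - u i] on the left and
   by [G'] on the right; one side then contains [(W - u i) (W + u i) = 0]. *)
have E0 : io c1 * ((W - u i) * F * (W + u i)) * io c2 = 0.
  have : P' * (F * (P * ((W + u i) * G))) = P' * (P * ((W + u i) * G) * F).
    by congr (P' * _); move: Eall; rewrite Es big_cat big_cons.
  rewrite (mulrA F) FP -!mulrA !(mulrA P') PP => /(congr1 (fun z => (W - u i) * z * G')).
  have c1Wu : GRing.comm (W - u i) (io c1).
    apply: commr_sym; apply: commrB; first exact: cW.
    by apply: comm_io; apply/commr_sym/comm_c/skew_poly_x.
  rewrite !(mulrA (W - u i)) c1Wu -!mulrA GG !(mulrA (W - u i)) => ->.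
  have -> : (W - u i) * (W + u i) = 0.
    by rewrite mulrDr !mulrBl uW addrA subrK -!expr2 WW /u -[io _ ^+ 2]ioM subrr.
  by rewrite !mul0r mulr0.
pose b := f * x i - x i * f; pose a := y * f - x i * f * x i.
have sb : skew_poly b by apply: skew_polyB; apply: skew_polyM => //; apply: skew_poly_x.
have EZ : (W - u i) * F * (W + u i) = io a + io b * W.
  rewrite comm_W; last exact: x_sqr_skew_comm.
  rewrite mulrDr !mulrBl /a /b !ioB (ioM y) -WW (ioM (x i * f)) !(ioM _ f) (ioM f) -/F -/(u i).
  have -> : W * F * W = W ^+ 2 * F by rewrite -mulrA FW mulrA.
  have -> : u i * F * W = W * u i * F by rewrite -mulrA FW mulrA uW.
  by rewrite mulrBr !mulrA addrACA [RHS]addrACA [- _ - _ * _]addrC.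
have c2Z : GRing.comm (io c2) ((W - u i) * F * (W + u i)).
  have c2u : GRing.comm (io c2) (u i) by apply: comm_io; apply/commr_sym/comm_c/skew_poly_x.
  have c2F : GRing.comm (io c2) F by apply: comm_io; apply/commr_sym/comm_c.
  by apply: commrM; [apply: commrM => //; apply: commrB | apply: commrD] => //; exact: cW.
(* The entry [(1, 0)] of [io a + io b * W] is [b]: scalar matrices are diagonal and [W] has entry 1
   there. *)
move: E0; rewrite -mulrA -c2Z mulrA -ioM EZ => /matrixP/(_ 1 0).
rewrite -[io _ * _]/((c1 * c2)%:M *m _) mul_scalar_mx -[io b * W]/(b%:M *m W) mul_scalar_mx.
rewrite !mxE /= mulr0n add0r mulr1 -mulrA => E.
apply/eqP; rewrite -subr_eq0 -/b; apply/eqP.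
apply: (skew_poly_prod_torsion_free is2) => //.
by apply: (skew_poly_prod_torsion_free is1) E; apply: skew_polyM => //; apply: skc.
Qed.

Lemma skew_act_word w : exists (e : k) m, skew_act (\prod_(i <- w) x i) 1 = e *: 'X_[m] /\ mdeg m = size w.
Proof.
elim: w => [|i w [e [m [E dm]]]].
  by exists 1, 0%MM; rewrite big_nil skew_act1 scale1r mpolyX0 mdeg0.
exists (e * (-1) ^+ (\sum_(l < n | (l < i)%N) m l)), (m + U_(i))%MM; split.
  by rewrite big_cons skew_actM E skew_act_x skewXZ skewX_Xm scalerA.
by rewrite mdegD mdeg1 addn1 dm.
Qed.

Lemma even_act_mdeg f m : in_word_span x (parity false) f ->
  (skew_act f 1)@_m != 0 -> ~~ odd (mdeg m).
Proof.
elim/in_word_span_ind => [|a f1 f2 IH1 IH2|w /eqP ew].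
- by rewrite skew_act0 mcoeff0 eqxx.
- rewrite skew_act_linear mcoeffD mcoeffZ.
  have [-> | /IH1 //] := eqVneq (skew_act f1 1)@_m 0; rewrite mulr0 add0r; exact: IH2.
have [e [m' [-> dm]]] := skew_act_word w; rewrite mcoeffZ mcoeffX.
by have [<-|] := eqVneq m' m; rewrite ?dm ?ew // mulr0 eqxx.
Qed.

Lemma x_normal_monomial i (m : 'X_{1..n}) :
  (\prod_(l < n) x l ^+ m l) * x i =
  (-1) ^+ (\sum_(l < n | l != i) m l) *: (x i * \prod_(l < n) x l ^+ m l) :> A.
Proof.
elim: (index_enum _) => [|a s IHs]; first by rewrite !big_nil mulr1 mul1r scale1r.
rewrite !big_cons -mulrA IHs -scalerAr !mulrA.
have [->|ai] := eqVneq a i; first by rewrite -exprSr -exprS.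
rewrite [x i * _](anticommuting_exp (x_anticommuting rel)) 1?eq_sym // -scalerAl scalerA.
by rewrite exprD mulrC mulrA -expr2 sqrr_sign mul1r.
Qed.

Lemma eval_sqE p : eval_sq x p = nf (fun i => x i ^+ 2) p.
Proof. by []. Qed.

(** Comparing [f x_i] with [x_i f], the exponents other than [m i] in each monomial have even sum:
    otherwise its coefficient would equal its opposite, hence vanish as 2 is nonzero. Since the
    total degree is even, so is [m i]. *)
Lemma even_comm_x_eval_sq f : (2%:R : k) != 0 -> in_word_span x (parity false) f ->
  (forall i, GRing.comm f (x i)) -> exists p, f = eval_sq x p.
Proof.
move=> k2 ef cf; have [P fP] := in_word_span_skew_poly ef.
have even_m m i : m \in msupp P -> ~~ odd (m i).
  move=> mP; pose e (m : 'X_{1..n}) := (\sum_(l < n | l != i) m l)%N.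
  (* [P'] records the signs produced when [x_i] passes from the right of each monomial to its
     left. *)
  pose P' := \sum_(m <- msupp P) (P@_m * (-1) ^+ e m) *: 'X_[m].
  have fx : f * x i = x i * nf x P'.
    rewrite fP linear_sum mulr_suml mulr_sumr; apply: eq_bigr => m' _.
    by rewrite linearZ /= nfXm -scalerAl x_normal_monomial -scalerAr scalerA.
  have PP' : P = P'.
    apply/eqP; rewrite -subr_eq0; apply/eqP/(@skewX_inj k n i).
    move: fx; rewrite cf fP !x_nf => /(congr1 (skew_act^~ 1)).
    by rewrite !skew_act_nf skewXB => ->; rewrite subrr.
  have := congr1 (mcoeff m) PP'; rewrite /P' linear_sum /= (bigD1_seq m) ?msupp_uniq //=.
  rewrite big1 ?addr0 => [|m' /negPf mm']; last by rewrite mcoeffZ mcoeffX mm' mulr0.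
  rewrite mcoeffZ mcoeffX eqxx mulr1 => Em.
  have ee : ~~ odd (e m).
    apply/negP => oe; move: mP; rewrite mcoeff_msupp.
    move: Em; rewrite -signr_odd oe expr1 mulrN1 => /eqP.
    by rewrite -addr_eq0 -mulr2n -mulr_natl mulf_eq0 (negPf k2) /= => ->.
  have : ~~ odd (mdeg m).
    by apply: (even_act_mdeg ef); rewrite fP skew_act_nf -mcoeff_msupp.
  by rewrite mdegE (bigD1 i) //= oddD (negPf ee) addbF.
exists (\sum_(m <- msupp P) P@_m *: 'X_[[multinom (m i)./2 | i < n]]).
rewrite eval_sqE linear_sum fP; apply: eq_big_seq => m mP.
rewrite linearZ /= nfXm; congr (_ *: _); apply: eq_bigr => i _.
by rewrite mnmE -exprM mul2n -[in LHS](odd_double_half (m i)) (negPf (even_m m i mP)).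
Qed.

(** * Polynomials in the squares and their divided differences *)

Lemma eval_sq_linear a p q : eval_sq x (a *: p + q) = a *: eval_sq x p + eval_sq x q.
Proof. by rewrite !eval_sqE linearP. Qed.

Lemma eval_sqB p q : eval_sq x (p - q) = eval_sq x p - eval_sq x q.
Proof. by rewrite !eval_sqE linearB. Qed.

Lemma eval_sqM p q : eval_sq x (p * q) = eval_sq x p * eval_sq x q.
Proof.
apply: nfM_comm => i j; rewrite [x j ^+ 2]expr2; apply: commrM; exact: x_sqr_comm rel _ _.
Qed.

Lemma eval_sqX i : eval_sq x 'X_i = x i ^+ 2.
Proof.
rewrite eval_sqE nfXm -[RHS](mmap1U (fun i => x i ^+ 2)) //.
Qed.

Lemma eval_sq_skew_poly p : skew_poly (eval_sq x p).
Proof.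
elim/mpoly_mulX_ind: p => [a p q Hp Hq||i m Hm].
- by rewrite eval_sq_linear; apply: skew_poly_linear.
- by rewrite eval_sqE nf1; apply: skew_poly1.
- by rewrite mpolyXD eval_sqM eval_sqX expr2; do 2?apply: skew_polyM => //; apply: skew_poly_x.
Qed.

(** Substituting squares doubles all exponents; distinct monomials stay distinct, so every
    coefficient survives. *)
Lemma eval_sq_inj p : eval_sq x p = 0 -> p = 0.
Proof.
pose p2 := \sum_(m <- msupp p) p@_m *: 'X_[k, (m *+ 2)%MM].
have -> : eval_sq x p = nf x p2.
  rewrite linear_sum; apply: eq_bigr => m _; rewrite linearZ /= nfXm.
  by congr (_ *: _); apply: eq_bigr => i _; rewrite mulmnE mulnC exprM.
move=> E; have {}E : p2 = 0 by rewrite -(skew_act_nf p2) E skew_act0.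
apply/mpolyP => m; rewrite mcoeff0; apply/eqP; apply: contraTT isT => pm.
have := congr1 (mcoeff (m *+ 2)) E.
rewrite linear_sum /= (bigD1_seq m) ?msupp_uniq ?mcoeff_msupp //=.
rewrite big1 => [|m' m'm]; last first.
  rewrite mcoeffZ mcoeffX; case: eqP => [/mnmP H|]; last by rewrite mulr0.
  case/eqP: m'm; apply/mnmP => i; have := H i; rewrite !mulmnE; lia.
by rewrite addr0 mcoeffZ mcoeffX eqxx mulr1 mcoeff0 => /eqP; rewrite (negPf pm).
Qed.
Lemma msymXU (s : {perm 'I_n}) i : msym s 'X_i = 'X_(s i) :> V.
Proof. by rewrite /msym mmapX mmap1U. Qed.

Definition adjacent j : {perm 'I_n} := tperm (ord_lo j) (ord_hi j).

Lemma ord_lo_hi (j : 'I_n.-1) : @ord_lo n j != @ord_hi n j.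
Proof. by rewrite -val_eqE /= ltn_eqF. Qed.

(** Twisted Leibniz rule for a square: [g] is [x_lo + x_hi], its opposite or 0. The last clause is
    the divided difference formula with its denominator cleared, a form that extends to products. *)
Lemma tau_x_sqr j i : exists g, [/\ skew_poly g,
  t j * x i ^+ 2 = x (adjacent j i) ^+ 2 * t j + g &
  (x (ord_lo j) ^+ 2 - x (ord_hi j) ^+ 2) * g =
  (x (ord_lo j) + x (ord_hi j)) * (x i ^+ 2 - x (adjacent j i) ^+ 2)].
Proof.
set a := x (ord_lo j); set b := x (ord_hi j).
have sab : skew_poly (a + b).
  rewrite -[a]scale1r; apply: skew_poly_linear; exact: skew_poly_x.
have cab : GRing.comm (a ^+ 2 - b ^+ 2) (a + b).
  by apply: commr_sym; apply: commrB; apply/commr_sym/x_sqr_skew_comm.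
have [->|il] := eqVneq i (ord_lo j).
  exists (a + b); rewrite /adjacent tpermL; split=> //.
  rewrite expr2 mulrA (tau_x_lo rel) mulrDl mul1r -mulrA (tau_x_lo rel).
  by rewrite mulrDr mulr1 mulrA -expr2 addrA addrC.
have [->|ih] := eqVneq i (ord_hi j).
  exists (- (a + b)); rewrite /adjacent tpermR; split.
  - by rewrite -scaleN1r -[_ *: _]addr0; apply: skew_poly_linear => //; exists 0; rewrite linear0.
  - rewrite expr2 mulrA (tau_x_hi rel) mulrBl mul1r -mulrA (tau_x_hi rel).
    by rewrite mulrBr mulr1 mulrA -expr2 -addrA -opprD.
  - by rewrite mulrN cab -mulrN opprB.
exists 0; rewrite /adjacent tpermD 1?eq_sym // subrr !mulr0 addr0; split=> //.
  by exists 0; rewrite linear0.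
by rewrite expr2 mulrA (tau_x_other rel) // mulNr -[x i * t j * _]mulrA (tau_x_other rel) // mulrN opprK mulrA.
Qed.

Lemma tau_eval_sq j p : exists g, [/\ skew_poly g,
  t j * eval_sq x p = eval_sq x (msym (adjacent j) p) * t j + g &
  (x (ord_lo j) ^+ 2 - x (ord_hi j) ^+ 2) * g =
  (x (ord_lo j) + x (ord_hi j)) * (eval_sq x p - eval_sq x (msym (adjacent j) p))].
Proof.
set a := x (ord_lo j); set b := x (ord_hi j).
elim/mpoly_mulX_ind: p => [c p q [g [sg E D]] [g' [sg' E' D']]||i m [g [sg E D]]].
- exists (c *: g + g'); split; first exact: skew_poly_linear.
    rewrite linearP /= !eval_sq_linear mulrDr -scalerAr E E' scalerDr addrACA.
    by rewrite mulrDl -scalerAl.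
  rewrite linearP /= !eval_sq_linear mulrDr -scalerAr D D' opprD addrACA -scalerBr.
  by rewrite [in RHS]mulrDr -scalerAr.
- exists 0; rewrite msym1 subrr !mulr0 addr0 eval_sqE nf1 mulr1 mul1r; split=> //.
  by exists 0; rewrite linear0.
have [d [sd Ed Dd]] := tau_x_sqr j i; set s := adjacent j in E D Ed Dd *.
have -> : 'X_[m + U_(i)] = 'X_i * 'X_[m] :> V by rewrite addmC mpolyXD.
rewrite msymM msymXU !eval_sqM !eval_sqX.
exists (x (s i) ^+ 2 * g + d * eval_sq x 'X_[m]); split.
- rewrite -[_ ^+ 2 * g]scale1r; apply: skew_poly_linear; apply: skew_polyM => //.
    by apply: skew_polyM; apply: skew_poly_x.
  exact: eval_sq_skew_poly.
- by rewrite mulrA Ed mulrDl -mulrA E mulrDr !mulrA addrA.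
rewrite mulrDr [_ * (d * _)]mulrA Dd mulrA.
have sab : skew_poly (a + b).
  rewrite -[a]scale1r; apply: skew_poly_linear; exact: skew_poly_x.
have sD : skew_poly (a ^+ 2 - b ^+ 2).
  by apply: skew_polyB; apply: skew_polyM; apply: skew_poly_x.
rewrite -(x_sqr_skew_comm (s i) sD) -mulrA D mulrA (x_sqr_skew_comm (s i) sab) -!mulrA.
by rewrite -mulrDr; congr (_ * _); rewrite !mulrA -!expr2 mulrBr mulrBl addrC addrA subrK.
Qed.

(** For symmetric [p] the cleared formula reads [(x_lo^2 - x_hi^2) g = 0], so [g] vanishes by
    torsion-freeness. *)
Lemma symmetric_eval_sq_tau j p : p \is symmetric -> GRing.comm (t j) (eval_sq x p).
Proof.
move=> /issymP ps; have [g [sg E D]] := tau_eval_sq j p.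
rewrite ps subrr mulr0 -[x (ord_hi j) ^+ 2]scale1r -scaleNr in D.
rewrite /GRing.comm E ps (skew_poly_torsion_free (ord_lo_hi j) sg D) addr0 //.
Qed.

(** Every transposition is obtained from adjacent ones by conjugation, by induction on the distance
    of its two points, and transpositions generate. *)
Lemma adjacent_symmetric (p : V) : (forall j, msym (adjacent j) p = p) -> p \is symmetric.
Proof.
move=> adj.
have conj (s u : {perm 'I_n}) : msym s p = p -> msym u p = p -> msym (s ^ u) p = p.
  move=> sp up; rewrite /conjg !msymMm.
  have -> : msym u^-1 p = p by rewrite -{1}up -msymMm mulgV msym1m.
  by rewrite sp.
have tp d : forall a b : 'I_n, b = (a + d.+1)%N :> nat -> msym (tperm a b) p = p.
  elim: d => [|d IHd] a b ab.
    have aj : (a < n.-1)%N by have := ltn_ord b; lia.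
    have eb : ord_hi (Ordinal aj) = b by apply: val_inj; rewrite /= ab addn1.
    have ea : ord_lo (Ordinal aj) = a by apply: val_inj.
    by have := adj (Ordinal aj); rewrite /adjacent ea eb.
  have cn : (a + d.+1 < n)%N by have := ltn_ord b; lia.
  pose c := Ordinal cn; have ac := IHd a c erefl.
  have cj : (c < n.-1)%N by have := ltn_ord b; rewrite /=; lia.
  have cb : msym (tperm c b) p = p.
    have eb : ord_hi (Ordinal cj) = b by apply: val_inj; rewrite /= ab !addnS.
    have ea : ord_lo (Ordinal cj) = c by apply: val_inj.
    by have := adj (Ordinal cj); rewrite /adjacent ea eb.
  have := conj _ _ ac cb; rewrite tpermJ tpermL tpermD //; rewrite -val_eqE /= ?ab; lia.
have {}tp a b : msym (tperm a b) p = p.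
  case: (ltngtP a b) => [ab|ba|/val_inj ->]; last by rewrite tperm1 msym1m.
    by apply: (tp (b - a).-1); lia.
  by rewrite tpermC; apply: (tp (a - b).-1); lia.
apply/issymP => s; have [ts -> _] := prod_tpermP s.
elim: ts => [|[a b] ts IHts]; first by rewrite big_nil msym1m.
by rewrite big_cons msymMm tp.
Qed.

(** On the vector 1 the term ending in [t j] dies, so [g] kills 1 and is zero. The cleared formula
    then says that [x_lo + x_hi] annihilates the difference between [p] and its exchange. *)
Lemma eval_sq_symmetric p : (forall j, skew_act (t j * eval_sq x p) 1 = 0) -> p \is symmetric.
Proof.
move=> tp; apply: adjacent_symmetric => j; have [g [sg E D]] := tau_eval_sq j p.
have g0 : g = 0.
  by apply: skew_poly_eq0 => //; have := tp j; rewrite E skew_actD skew_actM skew_act_t1 skew_act_r0 add0r.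
move: D; rewrite g0 mulr0 -eval_sqB => /esym D.
apply/esym/eqP; rewrite -subr_eq0; apply/eqP/eval_sq_inj.
apply: (skew_poly_torsion_free (a := 1) (ord_lo_hi j)); first exact: eval_sq_skew_poly.
(* By anticommutation the square of [x_lo + x_hi] is the torsion-free element [x_lo^2 + x_hi^2]. *)
have -> : x (ord_lo j) ^+ 2 + 1 *: x (ord_hi j) ^+ 2 =
    (x (ord_lo j) + x (ord_hi j)) * (x (ord_lo j) + x (ord_hi j)).
  rewrite scale1r mulrDl !mulrDr (x_anticommuting rel (ord_lo_hi j)).
  by rewrite addrA subrK -!expr2.
by rewrite -mulrA D mulr0.
Qed.

End Represented.

(** * The longest element *)

Section LongestElement.
Variables (k : fieldType) (n : nat) (A : algType k).
Variables (x : 'I_n -> A) (t : 'I_n.-1 -> A).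
Hypothesis rel : ONH_rel x t.

(** The extension by 0 makes products over intervals of natural numbers available. *)
Definition tau_nat (j : nat) : A := if insub j is Some o then t o else 0.

Lemma tau_natE (j : 'I_n.-1) : tau_nat j = t j.
Proof. by rewrite /tau_nat valK. Qed.

Lemma x_tau (j : 'I_n.-1) (i i' : 'I_n) : i = j :> nat -> i' = j.+1 :> nat ->
  x i * t j = 1 + t j * x i'.
Proof. by move=> ij ij'; have [<- _] := rel.2.2.2.2.2 j i i' ij ij'; rewrite subrK. Qed.

(* [theta] is, up to sign, the tau of the longest permutation of the first m+1
   strands.  Multiplying tau_i ... tau_m theta on the left by x_i strips off
   tau_i modulo a right multiple, so the two-sided ideal of [theta] is A. *)
Lemma longest_element m : (m <= n.-1)%N -> exists theta : A,
  [/\ forall j : 'I_n.-1, (j < m)%N -> t j * theta = 0,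
      forall c : A, (forall i, GRing.comm c (x i)) -> c * theta = 0 -> c = 0 &
      exists e : k, forall i : 'I_n, (m < i)%N -> x i * theta = e *: (theta * x i)].
Proof.
elim: m => [_|m IHm mn].
  exists 1; split=> //; first by move=> c _; rewrite mulr1.
  by exists 1 => i _; rewrite scale1r mulr1 mul1r.
have [theta [tth cth [e xth]]] := IHm (ltnW mn).
(* [v i] is [tau_i ... tau_m theta], with an empty product at [i = m + 1]. *)
have [v vm vS] : exists2 v : nat -> A, v m.+1 = theta &
    forall i : 'I_n.-1, (i <= m)%N -> v i = t i * v i.+1.
  exists (fun i => (\prod_(i <= l < m.+1) tau_nat l) * theta).
    by rewrite big_geq // mul1r.
  by move=> i im; rewrite big_ltn // tau_natE mulrA.
have ordm i : (i <= m)%N -> {o : 'I_n.-1 | o = i :> nat}.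
  by move=> im; exists (Ordinal (leq_ltn_trans im mn)).
(* [t l] anticommutes with all of [tau_i, ..., tau_m] and reaches [theta], which it kills because
   [l < m]. *)
have low (l : 'I_n.-1) d i : (i + d = m.+1)%N -> (l.+1 < i)%N -> t l * v i = 0.
  elim: d i => [|d IHd] i id li.
    by rewrite addn0 in id; rewrite id vm tth // -ltnS -id.
  have [|o oi] := ordm i; first by rewrite -ltnS -id addnS ltnS leq_addr.
  rewrite -oi in li id *; rewrite vS; last by rewrite -ltnS -id addnS ltnS leq_addr.
  rewrite mulrA (tau_far rel) ?li // mulNr -mulrA IHd ?mulr0 ?oppr0 //.
    by rewrite addSn -addnS.
  by rewrite ltnW.
(* For [i = j] a square vanishes. For [i < j], [t j] moves right until the braid relation replaces
   it by a product ending in [tau_(j-1)], which [low] kills. *)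
have high (j : 'I_n.-1) d i : (j <= m)%N -> (i + d = j)%N -> t j * v i = 0.
  elim: d i => [|d IHd] i jm id.
    by rewrite addn0 in id; rewrite id vS // mulrA (tau_sqr rel) mul0r.
  have im : (i <= m)%N by rewrite (leq_trans _ jm) // -id leq_addr.
  have [o oi] := ordm i im; rewrite -oi in id im *; rewrite vS //.
  case: d => [|d] in IHd id *.
    have jo : j = o.+1 :> nat by rewrite -id addn1.
    rewrite -jo vS // !mulrA; have /eqP := tau_braid rel jo.
    rewrite -addr_eq0 addrC addr_eq0 => /eqP ->; rewrite mulNr -(mulrA _ (t o) (v _)).
    rewrite (low o (m - j)%N) ?mulr0 ?oppr0 ?jo //.
    by rewrite addSn -jo subnKC.
  have oj : (o.+1 < j)%N by rewrite -id !addnS !ltnS leq_addr.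
  rewrite mulrA (tau_far rel) ?oj ?orbT // mulNr -mulrA IHd ?mulr0 ?oppr0 //.
  by rewrite addSn -addnS.
have xm : (m.+1 < n)%N by move: mn; case: (n) => //= n' ; rewrite ltnS.
pose xl : A := x (Ordinal xm).
(* Write [x_j tau_j = 1 + tau_j x_(j+1)] and use induction on the second term: [tau_j v_(j+2)] is
   zero by [low], leaving a right multiple of [v j]. *)
have strip d (j : 'I_n.-1) : (j + d = m)%N ->
    x (ord_lo j) * v j = v j.+1 + e *: (v j * xl).
  elim: d j => [|d IHd] j jd.
    rewrite addn0 in jd; rewrite vS ?jd // vm mulrA.
    rewrite (@x_tau j _ (Ordinal xm)) //=; last by rewrite jd.
    by rewrite mulrDl mul1r -mulrA xth //= -scalerAr mulrA.
  have jm : (j.+1 <= m)%N by rewrite -jd addnS ltnS leq_addr.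
  have [o oj] := ordm j.+1 jm; rewrite vS; last exact: ltnW.
  rewrite mulrA (@x_tau j _ (ord_lo o)) // mulrDl mul1r -!mulrA -oj IHd; last first.
    by rewrite oj addSn -addnS.
  rewrite mulrDr (low j d) ?add0r -?scalerAr ?mulrA ?oj //.
  by rewrite !addSn -addnS jd.
exists (v 0); split.
- by move=> j jm; apply: (high j j).
- move=> c cx c0; apply: (cth _ cx); rewrite -vm.
  (* By [strip], and since [c] commutes with [x_i], the vanishing climbs from [v 0] up to [v m.+1],
     which is [theta]. *)
  have cv i : (i <= m.+1)%N -> c * v i = 0.
    elim: i => // i IHi im; have [o oi] := ordm i im.
    have ci := IHi (ltnW im); rewrite -oi ltnS in ci im *.
    have := congr1 ( *%R c) (strip (m - o)%N o (subnKC im)).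
    by rewrite mulrA cx -mulrA ci mulr0 mulrDr -scalerAr mulrA ci mul0r scaler0 addr0.
  exact: cv.
exists ((-1) ^+ m.+1 * e) => i mi.
have th : x i * theta = e *: (theta * x i) by apply/xth/ltnW.
have xv d l : (l + d = m.+1)%N -> x i * v l = ((-1) ^+ d * e) *: (v l * x i).
  elim: d l => [|d IHd] l ld; first by rewrite addn0 in ld; rewrite ld vm mul1r.
  have lm : (l <= m)%N by rewrite -ltnS -ld addnS ltnS leq_addr.
  have [o ol] := ordm l lm; rewrite -ol in ld lm *; rewrite vS // mulrA.
  have -> : x i * t o = - (t o * x i).
    rewrite (tau_x_other rel) ?opprK // -val_eqE /= gtn_eqF //.
      by rewrite (leq_ltn_trans lm) // ltnW.
    by rewrite (leq_ltn_trans _ mi).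
  rewrite mulNr -[t o * x i * _]mulrA IHd; last by rewrite addSn -addnS.
  by rewrite -scalerAr mulrA -scaleNr exprS mulN1r mulNr.
exact: xv.
Qed.

End LongestElement.

(** * Symmetric polynomials in the squares *)

Section SquaresInOSym.
Variables (k : fieldType) (n : nat) (A : algType k).
Variables (x : 'I_n -> A) (t : 'I_n.-1 -> A).
Hypothesis rel : ONH_rel x t.

Lemma in_OSymM z z' : in_OSym x z -> in_OSym x z' -> in_OSym x (z * z').
Proof. exact: in_word_span_mul. Qed.

Lemma in_OSym_oelem r : in_OSym x (oelem x r).
Proof. exact: in_word_span_gen. Qed.

Lemma in_OSym_sum (I : Type) (r : seq I) (P : pred I) (F : I -> A) :
  (forall i, P i -> in_OSym x (F i)) -> in_OSym x (\sum_(i <- r | P i) F i).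
Proof.
move=> PF; elim/big_rec: _ => [|i z Pi Hz]; first exact: in_word_span0.
exact/in_word_spanD/Hz/PF.
Qed.

Lemma prod_rev_x (s : seq 'I_n) : uniq s ->
  \prod_(i <- rev s) x i = (-1) ^+ 'C(size s, 2) *: \prod_(i <- s) x i.
Proof.
have move_x a (r : seq 'I_n) : a \notin r ->
    (\prod_(i <- r) x i) * x a = (-1) ^+ size r *: (x a * \prod_(i <- r) x i).
  elim: r => [|b r IHr]; first by rewrite !big_nil mulr1 mul1r scale1r.
  rewrite inE negb_or !big_cons => /andP[ab ar].
  rewrite -mulrA IHr // -scalerAr !mulrA (x_anticommuting rel ab).
  by rewrite /= exprS mulN1r scaleNr mulNr scalerN opprK.
elim: s => [|a s IHs] /=; first by rewrite !big_nil scale1r.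
case/andP=> as_ us; rewrite rev_cons -cats1 big_cat big_seq1 /= IHs // -scalerAl.
by rewrite move_x // scalerA big_cons binS bin1 exprD.
Qed.

Lemma coef_in_OSym_mul (p q : {poly A}) :
  (forall i, in_OSym x p`_i) -> (forall i, in_OSym x q`_i) ->
  forall i, in_OSym x (p * q)`_i.
Proof. by move=> Hp Hq i; rewrite coefM; apply: in_OSym_sum => j _; apply: in_OSymM. Qed.

Lemma coef_in_OSym_sum (c : 'I_n.+1 -> A) : (forall r, in_OSym x (c r)) ->
  forall i, in_OSym x (\sum_(r < n.+1) (c r)%:P * 'X^(n - r))`_i.
Proof.
move=> Hc i; rewrite coef_sum; apply: in_OSym_sum => r _; rewrite coefCM coefXn.
by case: eqP => _; rewrite ?mulr1 ?mulr0 //; apply: in_word_span0.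
Qed.

Lemma oelemZ (c : k) (y : 'I_n -> A) r : oelem (fun i => c *: y i) r = c ^+ r *: oelem y r.
Proof.
rewrite /oelem scaler_sumr; apply: eq_bigr => S /eqP <-; rewrite cardE.
elim: (enum S) => [|i s IHs]; first by rewrite !big_nil scale1r.
by rewrite !big_cons IHs exprS -scalerAl -scalerAr scalerA.
Qed.

(* Both factors of prod_i (T + x_i) * prod_i^rev (T - x_i) = prod_i (T^2 - x_i^2)
   have odd elementary symmetric coefficients. *)
Lemma in_OSym_oelem_sqr r : in_OSym x (oelem (fun i => x i ^+ 2) r).
Proof.
pose u i : {poly A} := (x i)%:P.
have uX i : GRing.comm (u i) 'X by exact: commr_polyX.
have uu i j : GRing.comm (u i ^+ 2) (u j).
  by rewrite /u -rmorphXn /GRing.comm -!polyCM (x_sqr_comm rel).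
have [E _] := prod_conjugates (index_enum 'I_n) uX uu.
have E1 : \prod_i ('X + u i) = \sum_(r < n.+1) (oelem x r)%:P * 'X^(n - r).
  by rewrite -(prod_oelem (f := polyC)).
(* The signs come from the factors [- x_i] and from reversing [r] anticommuting letters. *)
have E2 : \prod_(i <- rev (index_enum 'I_n)) ('X - u i) =
    \sum_(r < n.+1) ((-1) ^+ r * (-1) ^+ 'C(r, 2) *: oelem x r)%:P * 'X^(n - r).
  rewrite (prod_rev_addr_comm (u := fun i => - u i)) => [|i]; last exact/commr_sym/commrN/commr_sym.
  rewrite sum_set_card; apply: eq_bigr => r' _; rewrite /oelem scaler_sumr rmorph_sum mulr_suml.
  apply: eq_bigr => S /eqP cS; rewrite cS; congr (_ * _).
  have sz : size (enum S) = r' by rewrite -cardE.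
  rewrite -scalerA -sz -prod_rev_x ?enum_uniq // -(size_rev (enum S)).
  elim: (rev _) => [|i s IHs]; first by rewrite !big_nil scale1r.
  rewrite !big_cons IHs /u /= exprS mulN1r scaleNr polyCN mulNr -polyCM.
  by rewrite scalerAr.
have E3 : \prod_i ('X ^+ 2 - u i ^+ 2) =
    \sum_(r < n.+1) ((-1) ^+ r *: oelem (fun i => x i ^+ 2) r)%:P * ('X ^+ 2) ^+ (n - r).
  under eq_bigr => i _ do rewrite /u -rmorphXn -rmorphN -scaleN1r.
  rewrite (prod_oelem (f := polyC) (x := fun i => -1 *: x i ^+ 2)) => [|i].
    by apply: eq_bigr => r' _; rewrite oelemZ.
  exact/commrX/commr_polyX.
have : in_OSym x ((-1) ^+ r *: oelem (fun i => x i ^+ 2) r).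
  (* Degree [2 (n - r)] singles out the [r]-th elementary symmetric polynomial of the squares. *)
  have := congr1 (fun p : {poly A} => p`_(2 * (n - r))) E; rewrite E1 E2 E3.
  rewrite [in RHS]coef_sum [RHS](bigD1 r) //= [X in _ = _ + X]big1 => [|r' r'r]; last first.
    rewrite coefCM -exprM coefXn eqn_mul2l /=; case: eqP => [H|]; last by rewrite mulr0.
    by case/eqP: r'r; apply: val_inj; rewrite /= -(subKn (leq_ord r)) H subKn ?leq_ord.
  rewrite addr0 coefCM -exprM coefXn eqxx mulr1 => <-.
  apply: coef_in_OSym_mul; apply: coef_in_OSym_sum => r'; first exact: in_OSym_oelem.
  by apply: in_word_spanZ; apply: in_OSym_oelem.
by move=> /(in_word_spanZ ((-1) ^+ r)); rewrite scalerA -expr2 sqrr_sign scale1r.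
Qed.

Lemma eval_sq_mesym (r : 'I_n.+1) : eval_sq x (mesym n k r) = oelem (fun i => x i ^+ 2) r.
Proof.
rewrite /mesym eval_sqE linear_sum; apply: eq_bigr => S _; rewrite /= -eval_sqE -big_enum /=.
elim: (enum S) => [|i s IHs]; first by rewrite !big_nil eval_sqE nf1.
by rewrite !big_cons (eval_sqM rel) IHs eval_sqX.
Qed.

(** The fundamental theorem on symmetric polynomials reduces the claim to elementary ones, treated
    in [in_OSym_oelem_sqr]. *)
Lemma eval_sq_in_OSym p : p \is symmetric -> in_OSym x (eval_sq x p).
Proof.
move=> ps; have [q [<- _]] := sym_fundamental ps.
rewrite comp_mpolyE eval_sqE linear_sum; apply: in_OSym_sum => m _.
rewrite linearZ /= -eval_sqE; apply: in_word_spanZ.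
elim/big_rec: _ => [|i z _ Hz]; first by rewrite eval_sqE nf1; apply: in_word_span1.
rewrite (eval_sqM rel); apply: in_OSymM => //; elim: (m i) => [|e IHe].
  by rewrite expr0 eval_sqE nf1; apply: in_word_span1.
rewrite exprS (eval_sqM rel); apply: in_OSymM => //.
(* The tuple entry at [i] has degree [i + 1], whence [lift ord0 i]. *)
rewrite tnth_mktuple -[i.+1]/(lift ord0 i : nat) eval_sq_mesym; exact: in_OSym_oelem_sqr.
Qed.

Lemma eval_sq_even p : ONH_even x t (eval_sq x p).
Proof.
have ev_mul z z' : ONH_even x t z -> ONH_even x t z' -> ONH_even x t (z * z').
  by apply: in_word_span_mul => w1 w2 o1 o2; rewrite size_cat oddD (negPf o1).
elim/mpoly_mulX_ind: p => [a p q Hp Hq||i m Hm].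
- by rewrite eval_sq_linear; apply: in_word_span_linear.
- by rewrite eval_sqE nf1; apply: in_word_span1.
rewrite mpolyXD (eval_sqM rel) eval_sqX; apply: ev_mul => //.
have -> : x i ^+ 2 = \prod_(g <- [:: inl i; inl i]) ONH_gen x t g.
  by rewrite !big_cons big_nil mulr1.
exact: in_word_span_word.
Qed.

Lemma eval_sq_comm_x p i : GRing.comm (eval_sq x p) (x i).
Proof.
apply: commr_sym; apply: commr_sum => m _; rewrite /GRing.comm -scalerAr -scalerAl.
congr (_ *: _); apply: commr_prod => l _; apply: commrX.
exact/commr_sym/(x_sqr_comm rel).
Qed.

End SquaresInOSym.

(** * The even center *)

Section Central.
Variables (k : fieldType) (n : nat) (A : algType k).
Variables (x : 'I_n -> A) (t : 'I_n.-1 -> A).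
Hypothesis hA : is_ONH x t.

Lemma ONH_rel_hom (B : algType k) (f : A -> B) : alg_hom f ->
  ONH_rel (fun i => f (x i)) (fun j => f (t j)).
Proof.
case=> fL fM f1; have [rel _] := hA.
have fB u v : f (u - v) = f u - f v.
  by rewrite addrC -scaleN1r fL scaleN1r addrC.
have f0 : f 0 = 0 by rewrite -(subrr 0) fB subrr.
have fN u : f (- u) = - f u by rewrite -sub0r fB f0 sub0r.
do 5?[split].
- by move=> i j ij; rewrite -!fM (x_anticommuting rel ij) fN.
- by move=> i j ij; rewrite -!fM (tau_far rel ij) fN.
- by move=> i j ij ij'; rewrite -!fM rel.2.2.1 // fN.
- by move=> j; rewrite -fM (tau_sqr rel) f0.
- by move=> j j' jj'; rewrite -!fM (tau_braid rel jj') fN.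
- move=> j i i' ij ij'; have [E1 E2] := rel.2.2.2.2.2 j i i' ij ij'.
  by rewrite -!fM -!fB E1 E2 f1.
Qed.

(* [a |-> a + e [z, a]] is an algebra map to the dual numbers; by uniqueness
   it is the inclusion as soon as [z, -] kills the generators. *)
Lemma comm_gen_central z : (forall i, GRing.comm z (x i)) ->
  (forall j, GRing.comm z (t j)) -> forall a, z * a = a * z.
Proof.
move=> zx zt a; pose inc (b : A) : dual A := (b, 0).
pose der (b : A) : dual A := (b, z * b - b * z).
have inc_hom : alg_hom inc.
  split=> [c u v|u v|] //; congr pair => /=; first by rewrite scaler0 addr0.
  by rewrite mulr0 mul0r addr0.
have der_hom : alg_hom der.
  split=> [c u v|u v|]; congr pair => /=.
  - by rewrite mulrDr mulrDl -scalerAr -scalerAl scalerBr opprD addrACA.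
  - by rewrite mulrBr mulrBl !mulrA [RHS]addrC addrA subrK.
  - by rewrite mulr1 mul1r subrr.
have [f [_ _ _ uniq_f]] := hA.2 _ _ _ (ONH_rel_hom inc_hom).
have Ei := uniq_f inc inc_hom (fun=> erefl) (fun=> erefl) a.
have Ed : der a = f a.
  apply: uniq_f => // [i|j]; congr pair; first by rewrite zx subrr.
  by rewrite zt subrr.
by move: Ed; rewrite -Ei => -[] /eqP; rewrite subr_eq0 => /eqP.
Qed.

End Central.

Section EvenCenter.
Variables (k : fieldType) (n : nat) (A : algType k).
Variables (x : 'I_n -> A) (t : 'I_n.-1 -> A).
Hypothesis hA : is_ONH x t.
Hypothesis k2 : (2%:R : k) != 0.

Let rel : ONH_rel x t := hA.1.

Lemma action_exists : exists phi : A -> endo {mpoly k[n]},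
  [/\ alg_hom phi, forall i, phi (x i) = skewX_endo k i & forall j, phi (t j) = tau_endo k j].
Proof.
have [phi [h hx ht _]] := hA.2 _ _ _ (polynomial_representation k n).
by exists phi.
Qed.

Lemma even_word_span (I : Type) (g : I -> A) z :
  in_word_span g (fun w => ~~ odd (size w)) z -> in_word_span g (parity false) z.
Proof. by apply: in_word_span_sub => w; rewrite /parity eqbF_neg. Qed.

Lemma symmetric_comm z : sym_in_squares x z -> forall a, z * a = a * z.
Proof.
case=> p [ps ->]; have [phi [h hx ht]] := action_exists.
apply: (comm_gen_central hA) => [i|j]; first exact: eval_sq_comm_x rel _ _.
exact/commr_sym/(symmetric_eval_sq_tau rel h hx).
Qed.

Lemma even_part z : ONH_even x t z -> exists f (b : 'I_n.-1 -> A),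
  in_word_span x (parity false) f /\ z = f + \sum_j b j * t j.
Proof. by move/even_word_span/(skew_part rel). Qed.

Section Action.
Variable phi : A -> endo {mpoly k[n]}.
Hypothesis h : alg_hom phi.
Hypothesis hx : forall i, phi (x i) = skewX_endo k i.
Hypothesis ht : forall j, phi (t j) = tau_endo k j.
Local Notation skew_act := (skew_act phi).
Local Notation skew := (skew_poly x).

(** The [t j] kill the vector 1, even after crossing [s]; the cases used are [s = 1] and
    [s = e_r]. *)
Lemma skew_act_tau_killed (b : 'I_n.-1 -> A) s : (forall j, exists c, t j * s = c * t j) ->
  skew_act ((\sum_j b j * t j) * s) 1 = 0.
Proof.
move=> ts; rewrite mulr_suml (skew_act_sum h) big1 // => j _; have [c E] := ts j.
by rewrite -mulrA E !(skew_actM h) (skew_act_t1 ht) !skew_act_r0.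
Qed.

Lemma skew_act_even_part f (b : 'I_n.-1 -> A) : skew_act (f + \sum_j b j * t j) 1 = skew_act f 1.
Proof.
rewrite (skew_actD h) -[\sum_j _]mulr1 skew_act_tau_killed ?addr0 // => j.
by exists 1; rewrite mulr1 mul1r.
Qed.

(** Common end of both characterisations; the two centers differ only in how these hypotheses are
    obtained. *)
Lemma sym_in_squares_skew f : in_word_span x (parity false) f ->
    (forall r, GRing.comm f (oelem x r)) -> (forall j, skew_act (t j * f) 1 = 0) ->
  sym_in_squares x f.
Proof.
move=> ef cf tf.
have sf := in_word_span_skew_poly rel ef.
have cx := comm_oelem_comm_x rel h hx sf cf.
have [p fp] := even_comm_x_eval_sq rel h hx k2 ef cx.
by exists p; split=> //; apply: (eval_sq_symmetric rel h hx ht) => j; rewrite -fp.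
Qed.

Lemma even_central_sym z : ONH_even x t z -> (forall a, z * a = a * z) -> sym_in_squares x z.
Proof.
move=> /even_part[f [b [ef zf]]] cz.
have sf := in_word_span_skew_poly rel ef.
have zf1 : skew_act z 1 = skew_act f 1 by rewrite zf skew_act_even_part.
have [p [ps fp]] : sym_in_squares x f.
  apply: sym_in_squares_skew => // [r|j].
    have se := oelem_skew_poly rel r.
    apply/eqP; rewrite -subr_eq0; apply/eqP/(skew_poly_eq0 rel h hx).
      by apply: (skew_polyB (x := x)); apply: (skew_polyM rel).
    (* [z e_r] and [e_r z] are compared on the vector 1, where [tau_oelem] removes the left ideal
       part of [z]. *)
    have := cz (oelem x r); rewrite {1}zf mulrDl => /(congr1 (skew_act^~ 1)).
    rewrite (skew_actD h) skew_act_tau_killed => [|j]; last exact: tau_oelem rel j r.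
    by rewrite addr0 (skew_actB h) => ->; rewrite !(skew_actM h) zf1 subrr.
  by rewrite (skew_actM h) -zf1 -(skew_actM h) -cz (skew_actM h) (skew_act_t1 ht) skew_act_r0.
exists p; split=> //; apply/eqP; rewrite -subr_eq0 -fp; apply/eqP.
(* With [m = n - 1] every [t j] kills [theta], hence so does [z - f]. *)
have [theta [tth cth _]] := longest_element rel (leqnn n.-1).
apply: cth => [i|].
  apply: commr_sym; apply: commrB; first by rewrite /GRing.comm cz.
  by rewrite fp; apply/commr_sym/(eval_sq_comm_x rel).
rewrite zf addrC addKr mulr_suml big1 // => j _.
by rewrite -mulrA tth ?mulr0.
Qed.

Lemma even_OSym_central_sym z : in_OSym x z -> ONH_even x t z ->
  (forall b, in_OSym x b -> z * b = b * z) -> sym_in_squares x z.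
Proof.
move=> oz /even_part[f [b [ef zf]]] cz.
have sf := in_word_span_skew_poly rel ef.
have sz := in_OSym_skew_poly rel oz.
(* Both are skew polynomials with the same value on 1. *)
have {b zf}zf : z = f.
  apply/eqP; rewrite -subr_eq0; apply/eqP/(skew_poly_eq0 rel h hx).
    exact: (skew_polyB (x := x)).
  by rewrite (skew_actB h) {1}zf skew_act_even_part subrr.
rewrite -zf in ef *; apply: sym_in_squares_skew => // [r|j].
  by apply: cz; apply: in_OSym_oelem.
(* [z] is only known to commute with [OSym_n]; instead [t j] crosses the factors [e_r] of [z] and
   ends on the right. *)
have [c ->] : exists c, t j * z = c * t j; last by rewrite (skew_actM h) (skew_act_t1 ht) skew_act_r0.
elim/in_word_span_ind: oz => [|a u v [cu Eu] [cv Ev]|w _].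
- by exists 0; rewrite mulr0 mul0r.
- by exists (a *: cu + cv); rewrite mulrDr -scalerAr Eu Ev mulrDl scalerAl.
elim: w => [|r w [c E]]; first by exists 1; rewrite big_nil mulr1 mul1r.
have [c' E'] := tau_oelem rel j r.
by exists (c' * c); rewrite big_cons mulrA E' -mulrA E mulrA.
Qed.

End Action.

End EvenCenter.

Theorem mainTheorem14 (k : fieldType) (hk : (2%:R : k) != 0) (n : nat)
    (hn : (1 <= n)%N) (A : algType k) (x : 'I_n -> A) (t : 'I_n.-1 -> A)
    (hA : is_ONH x t) :
  forall z : A,
    ((ONH_even x t z /\ forall a : A, z * a = a * z) <-> sym_in_squares x z) /\
    ((in_OSym x z /\ ONH_even x t z /\
        forall b : A, in_OSym x b -> z * b = b * z) <-> sym_in_squares x z).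
Proof.
move=> z; have [phi [h hx ht]] := action_exists hA.
split; split.
- by case=> ez cz; apply: (even_central_sym hA hk h hx ht).
- move=> sz; split; last by apply: (symmetric_comm hA).
  by have [p [_ ->]] := sz; apply: (eval_sq_even hA.1).
- by case=> oz [ez cz]; apply: (even_OSym_central_sym hA hk h hx ht).
move=> sz; split; last split.
- by have [p [ps ->]] := sz; apply: (eval_sq_in_OSym hA.1).
- by have [p [_ ->]] := sz; apply: (eval_sq_even hA.1).
by move=> b _; apply: (symmetric_comm hA).
Qed.
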